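(* Let $X_d$ be an RCB-space and let $X$ be reflexive. (i) The $X_d$-Bessel sequences for $X$ are precisely the sequences $(T\delta_i^* )_{i=1}^\infty$, where $T:X_d^*\to X^*$ is a bounded operator. (ii) The sequences $(g_i)_{i=1}^\infty$ in $X^*$ satisfying the lower $X_d$-frame condition are precisely the sequences $(T\delta_i^* )_{i=1}^\infty$, where the operator $T:\mathcal{D}(T)\to X^*$ satisfies the properties: $\mathcal{D}(T)$ is a linear subset of $X_d^*$ containing $\mathrm{span}\{\delta_i^*\}$; $T(\sum_{i=1}^n c_i\delta_i^* )\to T(\sum_{i=1}^\infty c_i\delta_i^* )$ as $n\to\infty$ for every $\sum_{i=1}^\infty c_i\delta_i^*\in\mathcal{D}(T)$; and there exists $\lambda\in(0,\infty)$ so that $\|T^*(F)\|\ge\lambda\|F\|$ for every $F\in\mathcal{D}(T^* )$. (iii) The $X_d$-frames for $X$ are precisely the sequences $(T\delta_i^* )_{i=1}^\infty$, where $T:X_d^*\to X^*$ is a bounded surjective operator. (iv) The Banach frames for $X$ with respect to $X_d$ are precisely the sequences $(T\delta_i^* )_{i=1}^\infty$, where $T:X_d^*\to X^*$ is a bounded surjective operator which has a bounded right inverse defined from $X^*$ into $X_d^*$. (v) The sequences $(g_i)_{i=1}^\infty$ in $X^*$ for which there exists a sequence $(f_i)_{i=1}^\infty$ in $X$ such that $((g_i)_{i=1}^\infty,(f_i)_{i=1}^\infty)$ is an atomic decomposition of $X$ with respect to $X_d$ are precisely the sequences $(T\delta_i^* )_{i=1}^\infty$, where $T:X_d^*\to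 X^*$ is a bounded surjective operator such that $T^*$ has a left inverse operator $L:\mathcal{D}(L)\to X$, with $\mathcal{D}(L)$ being a linear subset of $X_d$, satisfying $\mathcal{D}(L)\supseteq \mathrm{span}\{\delta_i\}\cup\mathcal{R}(T^* )$ and $$L\Big(\sum_{i=1}^n (T\delta_i^* )(f)\,\delta_i\Big)\to L\Big(\sum_{i=1}^\infty (T\delta_i^* )(f)\,\delta_i\Big)\quad\text{as } n\to\infty,\ \text{for every } f\in X.$$ (vi) The sequences $(f_i)_{i=1}^\infty$ in $X$ for which there exists a sequence $(g_i)_{i=1}^\infty$ in $X^*$ such that $((g_i)_{i=1}^\infty,(f_i)_{i=1}^\infty)$ is an atomic decomposition of $X$ with respect to $X_d$ are precisely the sequences $(T\delta_i)_{i=1}^\infty$, where the operator $T:\mathcal{D}(T)\to X$ satisfies: $\mathcal{D}(T)$ is a linear subset of $X_d$ containing $\mathrm{span}\{\delta_i\}$; $T(\sum_{i=1}^n c_i\delta_i)\to T(\sum_{i=1}^\infty c_i\delta_i)$ as $n\to\infty$ for every $\sum_{i=1}^\infty c_i\delta_i\in\mathcal{D}(T)$; and $T$ has a bounded right inverse $U:X\to X_d$ with $\mathcal{R}(U)\subseteq\mathcal{D}(T)$ and such that $U^*$ is surjective. (vii) The $X_d$-Riesz bases for $X$ are precisely the sequences $(T\delta_i)_{i=1}^\infty$, where $T:X_d\to X$ is a bounded bijective operator.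
   Context: $X$ is an infinite-dimensional separable Banach space with dual $X^*$; as $X$ is reflexive, $X^{**}$ is identified with $X$. ''Operator'' means linear mapping; $\mathcal{D}(V)$ and $\mathcal{R}(V)$ are the domain and range of an operator $V$; $\mathrm{span}$ denotes the set of all finite linear combinations. For a densely defined operator $T:\mathcal{D}(T)\subseteq E\to F$ between Banach spaces, $T^*:\mathcal{D}(T^* )\subseteq F^*\to E^*$ is its adjoint, where $\mathcal{D}(T^* )=\{\varphi\in F^*:\varphi T \text{ is bounded on }\mathcal{D}(T)\}$ and $T^*\varphi$ is the continuous extension of $\varphi T$ to $E$. $X_d$ is a Banach sequence space (a Banach space of scalar sequences). It is a BK-space if the coordinate functionals are continuous; a CB-space if the canonical vectors form a Schauder basis $(\delta_i)_{i=1}^\infty$ of $X_d$ (so $(c_i)=\sum c_i\delta_i$ for all $(c_i)\in X_d$); an RCB-space if it is a reflexive CB-space. For a CB-space $X_d$, the dual $X_d^*$ is identified with the BK-space $\{(V\delta_i)_{i=1}^\infty: V\in X_d^*\}$ with norm $\|(V\delta_i)\|=\|V\|_{X_d^*}$, the duality being $\sum c_id_i$ for $(c_i)\in X_d$, $(d_i)\in X_d^*$. If $X_d$ is an RCB-space, this sequence space is a CB-space, its canonical basis is denoted by $(\delta_i^* )_{i=1}^\infty$, and $X_d^{**}$ is identified with $X_d$. Let $g_i\in X^*$, $i\in\mathbb{N}$. Consider the conditions: (a) $(g_i(f))_{i=1}^\infty\in X_d$ for all $f\in X$; (b) there are positive constants $A,B$ with $A\|f\|_X\le\|(g_i(f))_{i=1}^\infty\|_{X_d}\le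 B\|f\|_X$ for all $f\in X$; (c) there is a bounded operator $Q:X_d\to X$ with $Q(g_i(f))_{i=1}^\infty=f$ for all $f\in X$. The sequence $(g_i)$ is an $X_d$-frame for $X$ if (a) and (b) hold; an $X_d$-Bessel sequence for $X$ if (a) and the upper inequality in (b) hold; a Banach frame for $X$ with respect to $X_d$ if (a), (b), (c) hold. It satisfies the lower $X_d$-frame condition if for some $A>0$ the lower inequality in (b) holds for all those $f\in X$ for which $(g_i(f))_{i=1}^\infty\in X_d$. For $f_i\in X$, the pair $((g_i),(f_i))$ is an atomic decomposition of $X$ with respect to $X_d$ if (a), (b) hold and $f=\sum_{i=1}^\infty g_i(f)f_i$ (norm convergence) for all $f\in X$. A sequence $(y_i)_{i=1}^\infty$ in a Banach space $Y$ is an $X_d$-Riesz basis for $Y$ if it is complete in $Y$ (its linear span is dense) and there are constants $A,B>0$ such that $A\|(c_i)\|_{X_d}\le\|\sum_{i=1}^\infty c_iy_i\|_Y\le B\|(c_i)\|_{X_d}$ for all $(c_i)_{i=1}^\infty\in X_d$ (in particular, the series converge). *)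

(* Defs.v *)
From HB Require Import structures.
From mathcomp Require Import all_boot all_order all_algebra.
From mathcomp Require Import complex.
From mathcomp Require Import all_classical all_reals all_analysis.

Set Implicit Arguments.
Unset Strict Implicit.
Unset Printing Implicit Defensive.

Import Order.TTheory GRing.Theory Num.Theory.
Import numFieldNormedType.Exports.

Local Open Scope classical_set_scope.
Local Open Scope ring_scope.

(** Scalar fields. MathComp norms take values in the scalar field itself, so
    the operator norm requires infima of sets of nonnegative scalars. The class
    below provides them; its two instances are [R] and [R[i]], for
    [R : realType]. *)

Definition is_glb (K : porderType ring_display) (A : set K) (m : K) : Prop :=
  lbound A m /\ forall l, lbound A l -> l <= m.

HB.mixin Record NumField_hasNonnegInf K & Num.NumField K := {
  nonneg_glb_ex : forall A : set K, A !=set0 -> A `<=` [set x | 0 <= x] ->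
    exists m, is_glb A m
}.

#[short(type="scalarFieldType")]
HB.structure Definition ScalarField :=
  {K of Num.NumField K & NumField_hasNonnegInf K}.

Lemma real_nonneg_glb (R : realType) (A : set R) :
  A !=set0 -> A `<=` [set x | 0 <= x] -> exists m, is_glb A m.
Proof.
move=> A0 Ap; exists (inf A); split.
  by move=> x Ax; apply: ge_inf => //; exists 0 => y /Ap.
by move=> l lA; apply: lb_le_inf.
Qed.

#[non_forgetful_inheritance]
HB.instance Definition _ (R : realType) :=
  NumField_hasNonnegInf.Build R (@real_nonneg_glb R).

Lemma complex_nonneg_glb (R : realType) (A : set R[i]) :
  A !=set0 -> A `<=` [set x | 0 <= x] -> exists m, is_glb A m.
Proof.
move=> A0 Ap.
have Are x : A x -> x = (complex.Re x)%:C%C.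
  by move=> /Ap /= /ger0_real xr; rewrite RRe_real.
pose B : set R := [set complex.Re x | x in A].
have B0 : B !=set0 by case: A0 => x Ax; exists (complex.Re x), x.
have Bp : B `<=` [set x | 0 <= x].
  by move=> _ [x Ax <-] /=; have := Ap _ Ax; rewrite /= (Are _ Ax) lecR.
have [m [mB mmax]] := real_nonneg_glb B0 Bp.
exists (m%:C)%C; split.
  by move=> x Ax; rewrite (Are _ Ax) lecR; apply: mB; exists x.
move=> l lA; have [x Ax] := A0.
have := lA _ Ax; rewrite (Are _ Ax) lecE /= => /andP[/eqP il _].
rewrite lecE /= -il eqxx /=; apply: mmax => _ [y Ay <-].
by have := lA _ Ay; rewrite (Are _ Ay) lecE /= => /andP[].
Qed.

HB.instance Definition _ (R : realType) :=
  NumField_hasNonnegInf.Build R[i] (@complex_nonneg_glb R).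

Definition bounded_on (K : numFieldType) (E F : normedModType K)
    (D : set E) (f : E -> F) : Prop :=
  exists M : K, forall x, D x -> `|f x| <= M * `|x|.

Definition bounded_op (K : numFieldType) (E F : normedModType K)
    (f : E -> F) : Prop := bounded_on setT f.

Definition surjective (A B : Type) (f : A -> B) : Prop :=
  forall y, exists x, f x = y.

Definition lin_span (K : numFieldType) (E : lmodType K) (u : nat -> E) :
  set E := [set x | exists n (c : nat -> K), x = \sum_(0 <= i < n) c i *: u i].

(** The dual space, with the operator norm. *)

Section Dual.
Variables (K : scalarFieldType) (E : normedModType K).

Definition dual_pred : {pred E -> K^o} :=
  [pred f : E -> K^o | `[< linear f /\ bounded_op f >] ].

Record dual : Type := Dual { dual_val :> E -> K^o; _ : dual_val \in dual_pred }.

HB.instance Definition _ := [isSub for dual_val].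
HB.instance Definition _ := [Choice of dual by <:].

Lemma dual_submod_closed : submod_closed dual_pred.
Proof.
split.
  apply/asboolP; split=> [a x y|]; first by rewrite /= scaler0 addr0.
  by exists 0 => x _; rewrite /= normr0 mul0r.
move=> a f g /asboolP[fl [M fM]] /asboolP[gl [N gN]]; apply/asboolP; split.
  move=> b x y; rewrite !addrfctE !scalrfctE fl gl !scalerDr !scalerA (mulrC a b).
  by rewrite -!addrA; congr (_ + _); rewrite addrCA.
exists (`|a| * M + N) => x _; rewrite addrfctE scalrfctE mulrDl.
apply: (le_trans (ler_normD _ _)); apply: lerD; last exact: gN.
by rewrite normrZ -mulrA ler_wpM2l// fM.
Qed.

HB.instance Definition _ :=
  GRing.isSubmodClosed.Build K (E -> K^o) dual_pred dual_submod_closed.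
HB.instance Definition _ := [SubChoice_isSubLmodule of dual by <:].

Lemma dual_linear (f : dual) : linear f.
Proof. by have /asboolP[] := valP f. Qed.

Lemma dual_bounded (f : dual) : bounded_op f.
Proof. by have /asboolP[] := valP f. Qed.

Definition dual_bounds (f : E -> K^o) : set K :=
  [set M | 0 <= M /\ forall x, `|f x| <= M * `|x|].

Definition dual_norm (f : dual) : K := xget 0 (is_glb (dual_bounds f)).

Lemma dual_bounds_neq0 (f : dual) : dual_bounds f !=set0.
Proof.
have [M fM] := dual_bounded f.
have [M0|M0] := pselect (0 <= M).
  by exists M; split=> // x; exact: fM.
exists 0; split=> // x; rewrite mul0r; have := fM x I.
have [->|x0] := eqVneq x 0; first by rewrite normr0 mulr0.
move=> /(le_trans (normr_ge0 _)).
by rewrite pmulr_lge0 ?normr_gt0// => /M0.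
Qed.

Lemma dual_norm_glb (f : dual) : is_glb (dual_bounds f) (dual_norm f).
Proof.
have [||m mP] := @nonneg_glb_ex K (dual_bounds f).
- exact: dual_bounds_neq0.
- by move=> x [].
- exact: (xgetPex 0 (ex_intro _ m mP)).
Qed.

Lemma dual_norm_ge0 (f : dual) : 0 <= dual_norm f.
Proof. by apply: (dual_norm_glb f).2 => x []. Qed.

Lemma le_dual_norm (f : dual) (x : E) : `|f x| <= dual_norm f * `|x|.
Proof.
have [->|x0] := eqVneq x 0.
  have := dual_linear f 0 0 0; rewrite scale0r addr0 scale0r add0r => e.
  have -> : f 0 = 0.
    by have [M fM] := dual_bounded f; have := fM 0 I;
      rewrite normr0 mulr0 normr_le0 => /eqP.
  by rewrite !normr0 mulr0.
rewrite -ler_pdivrMr ?normr_gt0//; apply: (dual_norm_glb f).2 => M [_ fM].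
by rewrite ler_pdivrMr ?normr_gt0.
Qed.

Lemma dual_norm_le (f : dual) (M : K) :
  0 <= M -> (forall x, `|f x| <= M * `|x|) -> dual_norm f <= M.
Proof. by move=> M0 fM; apply: (dual_norm_glb f).1. Qed.

Let dual_normD (f g : dual) : dual_norm (f + g) <= dual_norm f + dual_norm g.
Proof.
apply: dual_norm_le; first by rewrite addr_ge0 ?dual_norm_ge0.
move=> x; rewrite mulrDl; apply: (le_trans (ler_normD _ _)).
by rewrite lerD ?le_dual_norm.
Qed.

Let dual_normZ (a : K) (f : dual) : dual_norm (a *: f) = `|a| * dual_norm f.
Proof.
have leZ b (h : dual) : dual_norm (b *: h) <= `|b| * dual_norm h.
  apply: dual_norm_le; first by rewrite mulr_ge0 ?dual_norm_ge0.
  move=> x; rewrite -mulrA.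
  rewrite [X in `|X|](_ : _ = b *: h x)// normrZ.
  by rewrite ler_wpM2l// le_dual_norm.
apply/le_anti; rewrite leZ /=.
have [->|a0] := eqVneq a 0; first by rewrite normr0 mul0r dual_norm_ge0.
have := leZ a^-1 (a *: f); rewrite scalerA mulVf// scale1r normfV.
by rewrite -ler_pdivrMl ?invr_gt0 ?normr_gt0// invrK.
Qed.

Let dual_norm0_eq0 (f : dual) : dual_norm f = 0 -> f = 0.
Proof.
move=> f0; apply/val_inj/funext => x.
have := le_dual_norm f x; rewrite f0 mul0r normr_le0 => /eqP fx.
exact: fx.
Qed.

HB.instance Definition _ :=
  @Lmodule_isNormed.Build K dual dual_norm dual_normD dual_normZ dual_norm0_eq0.

End Dual.

Section Bidual.
Variables (K : scalarFieldType) (E : normedModType K).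

Lemma bidual_emb_subproof (x : E) :
  (fun f : dual E => f x : K^o) \in @dual_pred K (dual E).
Proof.
apply/asboolP; split=> //.
by exists `|x| => f _; rewrite mulrC; exact: le_dual_norm.
Qed.

Definition bidual_emb (x : E) : dual (dual E) := Dual (bidual_emb_subproof x).

Definition reflexive_space : Prop := surjective bidual_emb.

(** The identification of [E^**] with [E], for reflexive [E]. *)
Definition bidual_inv (G : dual (dual E)) : E :=
  xget 0 [set x | bidual_emb x = G].

End Bidual.

(** Linear operators defined on a subspace; the values of [op_fun] outside
    [dom] are irrelevant. *)

Record operator (K : numFieldType) (E F : lmodType K) := Operator {
  dom : set E;
  op_fun :> E -> F;
  dom0 : dom 0;
  dom_lin : forall (a : K) x y, dom x -> dom y -> dom (a *: x + y);
  op_lin : forall (a : K) x y, dom x -> dom y ->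
    op_fun (a *: x + y) = a *: op_fun x + op_fun y
}.

Definition total_op (K : numFieldType) (E F : lmodType K)
    (T : {linear E -> F}) : operator E F :=
  @Operator K E F setT T I (fun _ _ _ _ _ => I)
    (fun a x y _ _ => linearP T a x y).

(** [T (\sum_(i < n) c_i u_i)] converges to [T (\sum_i c_i u_i)] whenever the
    latter series converges to a point of the domain. *)
Definition series_continuous (K : numFieldType) (E F : normedModType K)
    (T : operator E F) (u : nat -> E) : Prop :=
  forall (c : nat -> K) (x : E),
    series (fun i => c i *: u i) @ \oo --> x -> dom T x ->
    (fun n => T (series (fun i => c i *: u i) n)) @ \oo --> T x.

(** The adjoint of a densely defined operator. *)

Section Adjoint.
Variables (K : scalarFieldType) (E F : normedModType K) (T : operator E F).

Definition adjoint_dom : set (dual F) :=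
  [set phi | bounded_on (dom T) (fun x => phi (T x))].

Definition adjoint (phi : dual F) : dual E :=
  xget 0 [set psi : dual E | forall x, dom T x -> psi x = phi (T x)].

End Adjoint.

(** The adjoint of a bounded [T : E^* -> F^*], seen as a map from [F] to [E]
    through [F^** = F] and [E^** = E]. *)
Definition reflexive_adjoint (K : scalarFieldType) (E F : normedModType K)
    (T : {linear dual E -> dual F}) (f : F) : E :=
  bidual_inv (adjoint (total_op T) (bidual_emb f)).

Definition infinite_dimensional (K : numFieldType) (E : lmodType K) : Prop :=
  forall (n : nat) (b : 'I_n -> E),
    exists x, forall c : 'I_n -> K, x <> \sum_(i < n) c i *: b i.

Definition separable (T : topologicalType) : Prop :=
  exists A : set T, countable A /\ dense A.

Definition schauder_basis (K : numFieldType) (E : normedModType K)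
    (u : nat -> E) : Prop :=
  forall x : E, exists! c : nat -> K,
    series (fun i => c i *: u i) @ \oo --> x.

(** A Banach sequence space: [ss_seq] identifies the elements of the Banach
    space [ss_space] with scalar sequences. *)
Record seq_space (K : numFieldType) := SeqSpace {
  ss_space :> completeNormedModType K;
  ss_seq : ss_space -> nat -> K;
  ss_linear : forall (a : K) (x y : ss_space) (i : nat),
    ss_seq (a *: x + y) i = a * ss_seq x i + ss_seq y i;
  ss_inj : injective ss_seq
}.

Definition unit_seq (K : numFieldType) (i : nat) : nat -> K :=
  fun j => (j == i)%:R.

Definition seq_in (K : numFieldType) (Xd : seq_space K) (s : nat -> K) : Prop :=
  exists c : Xd, ss_seq c = s.

(** The element of [Xd] which is the sequence [s] (0 if [s] is not in [Xd]). *)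
Definition of_seq (K : numFieldType) (Xd : seq_space K) (s : nat -> K) : Xd :=
  xget 0 [set c : Xd | ss_seq c = s].

Definition canon_vec (K : numFieldType) (Xd : seq_space K) (i : nat) : Xd :=
  of_seq Xd (unit_seq K i).

(** [ss_seq c] is required to be the coefficient sequence of [c] in the basis:
    this does not follow from the first two clauses unless the coordinate
    functionals of [Xd] are continuous. *)
Definition CB_space (K : numFieldType) (Xd : seq_space K) : Prop :=
  [/\ forall i, seq_in Xd (unit_seq K i),
      schauder_basis (canon_vec Xd) &
      forall c : Xd, series (fun i => ss_seq c i *: canon_vec Xd i) @ \oo --> c].

Definition RCB_space (K : scalarFieldType) (Xd : seq_space K) : Prop :=
  CB_space Xd /\ reflexive_space Xd.

(** [V : Xd^*] is identified with the sequence [dual_seq V]; the vector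
    [dual_canon_vec Xd i] is the one identified with the i-th canonical sequence. *)
Definition dual_seq (K : scalarFieldType) (Xd : seq_space K) (V : dual Xd) :
  nat -> K := fun j => V (canon_vec Xd j).

Definition dual_canon_vec (K : scalarFieldType) (Xd : seq_space K) (i : nat) :
  dual Xd := xget 0 [set V : dual Xd | dual_seq V = unit_seq K i].

Section Frames.
Variables (K : scalarFieldType) (Xd : seq_space K).
Variable X : completeNormedModType K.
Implicit Types (g : nat -> dual X) (f : nat -> X).

Definition coef_seq g (x : X) : nat -> K := fun i => g i x.

Definition coefs_in g : Prop := forall x, seq_in Xd (coef_seq g x).

Definition coef g (x : X) : Xd := of_seq Xd (coef_seq g x).

Definition frame_bounds g : Prop :=
  exists A B : K, [/\ 0 < A, 0 < B &
    forall x : X, A * `|x| <= `|coef g x| <= B * `|x| ].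

Definition Xd_frame g : Prop := coefs_in g /\ frame_bounds g.

Definition Xd_Bessel g : Prop :=
  coefs_in g /\
  exists B : K, 0 < B /\ forall x : X, `|coef g x| <= B * `|x|.

Definition lower_Xd_frame g : Prop :=
  exists A : K, 0 < A /\
    forall x : X, seq_in Xd (coef_seq g x) -> A * `|x| <= `|coef g x|.

Definition Banach_frame g : Prop :=
  [/\ coefs_in g, frame_bounds g &
    exists Q : {linear Xd -> X},
      bounded_op Q /\ forall x : X, Q (coef g x) = x].

Definition atomic_decomposition g f : Prop :=
  [/\ coefs_in g, frame_bounds g &
    forall x : X, series (fun i => g i x *: f i) @ \oo --> x].

Definition Xd_Riesz_basis f : Prop :=
  dense (lin_span f) /\
  exists A B : K, [/\ 0 < A, 0 < B &
    forall c : Xd, exists s : X,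
      series (fun i => ss_seq c i *: f i) @ \oo --> s /\
      A * `|c| <= `|s| <= B * `|c| ].

End Frames.

(* Main.v *)
Require Import Defs.
From HB Require Import structures.
From mathcomp Require Import all_boot all_order all_algebra.
From mathcomp Require Import complex.
From mathcomp Require Import all_classical all_reals all_analysis.
From mathcomp Require Import ring.

Set Implicit Arguments.
Unset Strict Implicit.
Unset Printing Implicit Defensive.

Import Order.TTheory GRing.Theory Num.Theory.
Import numFieldNormedType.Exports.

Local Open Scope classical_set_scope.
Local Open Scope ring_scope.

(** Write [delta'] for the sequence of coordinate functionals of [Xd]. A sequence [g]
    in [X^*] is determined by its analysis operator [x |-> (g_i(x))_i], and the
    statements on frames come from dualizing this operator: if it maps [X] to
    [Xd] and is bounded, its adjoint [T : Xd^* -> X^*] satisfies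
    [T delta'_i = g_i]; conversely, for a bounded [T] with [T delta'_i = g_i], the
    functional [V |-> (T V) x] is by reflexivity of [Xd] the evaluation at some [c]
    in [Xd], and [c_i = delta'_i(c) = g_i(x)], so that [T] is the adjoint of the
    analysis operator of [g] (Bessel_operator, operator_Bessel). Under this
    correspondence a lower frame bound becomes surjectivity of [T]
    (Bessel_frame_bounds), and left inverses of the analysis operator become right
    inverses of [T]. When the operators are only defined on a subspace, the same
    computation is done on the largest domain on which the relevant series
    converges (synth_ex), and series continuity replaces boundedness
    (lower_frame_iff, atomic_synthesis_iff). Riesz bases need no duality: their
    synthesis operator is bounded, bounded below and of dense range, hence bijective,
    and conversely the inverse of a bounded bijection is bounded (Riesz_basis_iff).

    This rests on classical facts which hold for real and complex scalars. The
    Hahn-Banach theorem is proved for linear relations, first over the reals with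
    Zorn's lemma and then over the complex numbers by passing to real parts. It
    gives norming functionals, hence the isometric identification of a reflexive
    space with its bidual, the density criterion for spans, and the surjectivity of
    the adjoint of an operator that is bounded below (bounded_below_surj).
    Zabreiko's lemma on countably subadditive seminorms, deduced from Baire's
    theorem, gives two further facts: the open mapping theorem, from which the
    converse of the last assertion follows (surj_bounded_below), and the uniform
    boundedness of the partial sum operators of a basis (psum_bounded). The latter
    makes the coordinate functionals continuous; since their span is dense when
    [Xd] is reflexive, [V = sum_i V(delta_i) delta'_i] for all [V] in [Xd^*]
    (dual_basis_cvg).

    Norms take values in the scalar field, so that limits are handled there, where
    nonnegative elements have infima. Only the Hahn-Banach theorem and the
    completeness of the scalars distinguish the real case from the complex one. *)

(** * Sequences in normed spaces over a scalar field *)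

Section Limits.
Variables (K : numFieldType) (E : normedModType K).
Implicit Types (u : nat -> E) (l : E).

Lemma cvgn_leP u l :
  u @ \oo --> l <->
  forall e : K, 0 < e -> exists N, forall n, (N <= n)%N -> `|l - u n| <= e.
Proof.
split=> [/cvgrPdist_le h e /h[N _ hN]|h]; first by exists N.
by apply/cvgrPdist_le => e /h[N hN]; exists N.
Qed.

Lemma cvgn_uniq u l l' : u @ \oo --> l -> u @ \oo --> l' -> l = l'.
Proof. by move=> ul ul'; exact: (cvg_unique (@norm_hausdorff _ E) ul ul'). Qed.

Lemma cvgn_dist_le u l (a : E) (M : K) : u @ \oo --> l ->
  (exists N, forall n, (N <= n)%N -> `|a - u n| <= M) -> `|a - l| <= M.
Proof.
move=> /cvgn_leP ul [N hN]; apply/ler_addgt0Pr => e /ul[N' hN'].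
have -> : a - l = (a - u (maxn N N')) - (l - u (maxn N N')).
  by rewrite opprB addrA subrK.
rewrite (le_trans (ler_normB _ _))// lerD ?hN ?hN'//; first exact: leq_maxl.
exact: leq_maxr.
Qed.

Lemma cvgn_bounded u l : u @ \oo --> l ->
  exists2 M : K, 0 <= M & forall n, `|u n| <= M.
Proof.
move=> /cvgP/cvg_seq_bounded[M [Mr uM]].
exists (`|M| + 1); first by rewrite addr_ge0.
move=> n; apply: (uM (`|M| + 1)) => //.
by rewrite (le_lt_trans (real_ler_norm Mr))// ltrDl.
Qed.

End Limits.

Section BoundedOn.
Variables (K : numFieldType) (E F : normedModType K).

(** Any bound of an operator can be taken nonnegative: a bound that is not
    nonnegative is only possible if the operator lives at the origin. *)
Lemma bounded_on_ge0 (D : set E) (f : E -> F) : bounded_on D f ->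
  exists2 M : K, 0 <= M & forall x, D x -> `|f x| <= M * `|x|.
Proof.
move=> [M fM]; have [M0|M0] := pselect (0 <= M); first by exists M.
exists 0 => // x Dx; have := fM x Dx; have [->|x0] := eqVneq x 0.
  by rewrite normr0 !mulr0.
move=> /(le_trans (normr_ge0 _)); rewrite pmulr_lge0 ?normr_gt0//.
Qed.

Lemma bounded_op_gt0 (f : E -> F) : bounded_op f ->
  exists2 M : K, 0 < M & forall x, `|f x| <= M * `|x|.
Proof.
move=> /bounded_on_ge0[M M0 fM]; exists (M + 1); first by rewrite ltr_wpDl.
by move=> x; rewrite (le_trans (fM x I))// ler_wpM2r// lerDl.
Qed.

Lemma bounded_op_cvg (T : {linear E -> F}) u l :
  bounded_op T -> u @ \oo --> l -> T \o u @ \oo --> T l.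
Proof.
move=> /bounded_op_gt0[M M0 TM] /cvgn_leP ul; apply/cvgn_leP => e e0.
have [N hN] := ul (e / M) (divr_gt0 e0 M0); exists N => n Nn /=.
by rewrite -linearB (le_trans (TM _))// -ler_pdivlMl// mulrC hN.
Qed.

Lemma op_series (T : {linear E -> F}) (u : nat -> E) n :
  T (series u n) = series (T \o u) n.
Proof. by rewrite /series /= linear_sum. Qed.

End BoundedOn.

(** * Geometric sequences *)

(** Convergence of the sequences whose increments decay geometrically: the
    form in which completeness is used throughout. *)
Definition geo_complete (K : numFieldType) (E : normedModType K) : Prop :=
  forall (u : nat -> E) (M : K),
    (forall n, `|u n.+1 - u n| <= M * 2^-1 ^+ n) -> exists l : E, u @ \oo --> l.

Section Geometric.
Variable K : scalarFieldType.
Local Notation h := (2^-1 : K).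

Lemma half_gt0 n : 0 < h ^+ n.
Proof. by rewrite exprn_gt0// invr_gt0. Qed.

(** If [m] is the infimum of the powers of [1/2] then so is [2m], hence [m]
    vanishes. *)
Lemma half_lt (e : K) : 0 < e -> exists n, h ^+ n < e.
Proof.
move=> e0; apply: contrapT => /forallNP he.
have [||m [mlb mmax]] := @nonneg_glb_ex K (range (fun n => h ^+ n)).
- by exists (h ^+ 0), 0.
- by move=> _ [n _ <-]; exact/ltW/half_gt0.
have em : e <= m.
  apply: mmax => _ [n _ <-]; rewrite real_leNgt; first exact/negP/he.
    exact: gtr0_real.
  exact/gtr0_real/half_gt0.
have /mmax : lbound (range (fun n => h ^+ n)) (m * 2).
  move=> _ [n _ <-]; rewrite -ler_pdivlMr// -exprSr; apply: mlb.
  by exists n.+1.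
rewrite mulr_natr mulr2n gerDl => m0.
by have := lt_le_trans e0 (le_trans em m0); rewrite ltxx.
Qed.

Lemma half_small (M e : K) : 0 <= M -> 0 < e ->
  exists N, forall n, (N <= n)%N -> M * h ^+ n <= e.
Proof.
move=> M0 e0; have M1 : 0 < M + 1 by rewrite ltr_wpDl.
have [N hN] := half_lt (divr_gt0 e0 M1); exists N => n Nn.
apply: (@le_trans _ _ ((M + 1) * h ^+ N)).
  rewrite ler_pM ?(ltW (half_gt0 _))// ?lerDl//.
  by rewrite ler_wiXn2l ?invr_ge0// invf_le1// ler1n.
by rewrite -ler_pdivlMl// mulrC ltW.
Qed.

Section GeoSeq.
Variables (E : normedModType K) (u : nat -> E) (M : K).
Hypothesis uM : forall n, `|u n.+1 - u n| <= M * h ^+ n.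

Lemma geo_dist n k : `|u (n + k)%N - u n| <= M * 2 * (h ^+ n - h ^+ (n + k)).
Proof.
elim: k => [|k IH]; first by rewrite addn0 !subrr normr0 mulr0.
rewrite addnS -[X in `|X|](subrKA (u (n + k)%N)) (le_trans (ler_normD _ _))//.
apply: (le_trans (lerD (uM _) IH)).
suff -> : M * h ^+ (n + k) = M * 2 * (h ^+ (n + k) - h ^+ (n + k).+1).
  by rewrite -mulrDr addrC subrKA.
rewrite exprSr -{2}[h ^+ (n + k)]mulr1 -mulrBr mulrACA -mulrA; congr (_ * _).
by rewrite mulrBr mulr1 divff// -[2]/(1 + 1) addrK mulr1.
Qed.

Lemma geo_bound_ge0 : 0 <= M.
Proof. by have := le_trans (normr_ge0 _) (uM 0); rewrite expr0 mulr1. Qed.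

Lemma geo_dist_le n k : `|u (n + k)%N - u n| <= M * 2 * h ^+ n.
Proof.
rewrite (le_trans (geo_dist n k))// ler_wpM2l ?mulr_ge0 ?geo_bound_ge0//.
by rewrite gerBl ltW// half_gt0.
Qed.

Lemma geo_cvg_dist l n : u @ \oo --> l -> `|u n - l| <= M * 2 * h ^+ n.
Proof.
move=> /cvgn_dist_le; apply; exists n => m /subnKC <-.
by rewrite distrC geo_dist_le.
Qed.

End GeoSeq.

Lemma complete_geo (E : completeNormedModType K) : geo_complete E.
Proof.
move=> u M uM; have M0 := geo_bound_ge0 uM.
suff : cvgn u by move=> /cvg_ex.
apply/cauchy_cvgP/cauchy_exP => e e0.
have [||N hN] := @half_small (M * 2) (e / 2); rewrite ?mulr_ge0 ?divr_gt0//.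
exists (u N); exists N => // n /= /subnKC <-; rewrite -ball_normE /=.
rewrite distrC (le_lt_trans (geo_dist_le uM _ _))//.
by rewrite (le_lt_trans (hN N _))// gtr_pMr// invf_lt1// ltr1n.
Qed.

End Geometric.

(** * Baire's theorem, Zabreiko's lemma and the open mapping theorem *)

Section Baire.
Variables (K : scalarFieldType) (E : normedModType K).
Hypothesis Ec : geo_complete E.

Let two_gt0 : 0 < 2 :> K. Proof. by rewrite ltr0n. Qed.

Let pos_lb (a b : K) : 0 < a -> 0 < b -> exists c, [/\ 0 < c, c <= a & c <= b].
Proof.
move=> a0 b0; have [ab|/ltW ba] := real_leP (gtr0_real a0) (gtr0_real b0).
  by exists a.
by exists b.
Qed.

(** If the closure of no [A n] contains a ball, then nested balls [B (a k) (r k)]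
    can be chosen with [r k] decaying geometrically and the ball of index [k.+1]
    at positive distance from [A k]; the limit of the centers lies in no [A k]. *)
Lemma baire_cover (A : nat -> set E) : (forall x, exists n, A n x) ->
  exists n (a : E) (r : K), 0 < r /\
    forall y, `|y - a| < r -> forall e : K, 0 < e ->
      exists2 z, A n z & `|y - z| < e.
Proof.
move=> Acov; apply: contrapT => noball.
have step (s : nat * (E * K)) : exists t : E * K, 0 < s.2.2 ->
    [/\ 0 < t.2, `|t.1 - s.2.1| + t.2 <= s.2.2, t.2 <= s.2.2 / 2 &
        forall z, A s.1 z -> t.2 < `|t.1 - z|].
  case: s => n [a r] /=; have [r0|?] := pselect (0 < r); last by exists (a, r).
  have [y [ya [e [e0 ye]]]] : exists y, `|y - a| < r /\ exists e : K, 0 < e /\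
      forall z, A n z -> ~ `|y - z| < e.
    apply: contrapT => H; apply: noball; exists n, a, r; split=> // y yr e e0.
    apply: contrapT => H'; apply: H; exists y; split=> //; exists e.
    by split=> // z Az yz; apply: H'; exists z.
  have [b [b0 b1 b2]] := @pos_lb (e / 2) (r / 2) (divr_gt0 e0 two_gt0)
    (divr_gt0 r0 two_gt0).
  have [|c [c0 c1 c2]] := @pos_lb b (r - `|y - a|) b0; first by rewrite subr_gt0.
  exists (y, c) => _ /=; split=> //.
  - by rewrite addrC -lerBrDr.
  - exact: le_trans b2.
  move=> z /ye nyz; have yz : e <= `|y - z|.
    rewrite real_leNgt; [exact/negP|exact: gtr0_real|exact: normr_real].
  apply: lt_le_trans yz; apply: (le_lt_trans (le_trans c1 b1)).
  by rewrite gtr_pMr// invf_lt1// ltr1n.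
have [nxt nxtP] := choice step.
pose fix ar k := if k is k'.+1 then nxt (k', ar k') else (0, 1) : E * K.
have r0 k : 0 < (ar k).2.
  by elim: k => [|k IH] //=; have [] := nxtP (k, ar k) IH.
have arP k := nxtP (k, ar k) (r0 k).
have rle k : (ar k).2 <= 2^-1 ^+ k.
  elim: k => [|k IH] //; have [_ _ + _] := arP k => /le_trans; apply.
  by rewrite exprSr ler_wpM2r// invr_ge0.
have dist k j : `|(ar (k + j)%N).1 - (ar k).1| + (ar (k + j)%N).2 <= (ar k).2.
  elim: j => [|j IH]; first by rewrite addn0 subrr normr0 add0r.
  rewrite addnS; have [_ h _ _] := arP (k + j)%N; apply: le_trans IH.
  rewrite -(subrKA (ar (k + j)%N).1) (le_trans (lerD (ler_normD _ _) (lexx _)))//.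
  by rewrite addrAC addrC lerD2l.
have dist1 k j : `|(ar k).1 - (ar (k + j)%N).1| <= (ar k).2.
  rewrite distrC; apply: le_trans (dist k j); rewrite lerDl; exact: ltW.
have [|l al] := Ec (u := fun k => (ar k).1) (M := 1).
  move=> k; rewrite mul1r distrC -addn1; exact: le_trans (dist1 k 1%N) (rle k).
have [n Anl] := Acov l; have [_ _ _ /(_ l Anl)] := arP n.
suff h : `|(ar n.+1).1 - l| <= (ar n.+1).2.
  by move=> /lt_le_trans/(_ h); rewrite ltxx.
apply: (cvgn_dist_le al); exists n.+1 => m /subnKC <-; exact: dist1.
Qed.

(** Zabreiko's lemma: a countably subadditive seminorm on a Banach space is
    bounded. The seminorm [p] enters through the relation [P x M], read as
    [p x <= M], because it is in general an infimum or a supremum that need not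
    be formed. By Baire's theorem some closure of [p <= n] contains a ball, hence
    (taking differences) every small [x] is approximated by elements of bounded
    [p]; iterating on the error writes [x] as a series on which [p] decays
    geometrically. *)
Theorem zabreiko (P : E -> K -> Prop) :
  (forall x, exists2 M, 0 <= M & P x M) ->
  (forall x M N, P x M -> M <= N -> P x N) ->
  (forall x y M N, P x M -> P y N -> P (x - y) (M + N)) ->
  (forall (a : K) x M, P x M -> P (a *: x) (`|a| * M)) ->
  (forall u x M, 0 <= M -> (forall k, P (u k) (M * 2^-1 ^+ k)) ->
     series u @ \oo --> x -> P x (2 * M)) ->
  exists2 C : K, 0 < C & forall x, P x (C * `|x|).
Proof.
move=> Pex Ple PB PZ Psum.
have [|n [a [r [r0 arP]]]] := @baire_cover (fun n => [set x | P x (2 ^+ n)]).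
  move=> x; have [M M0 PM] := Pex x.
  have M1 : 0 < M + 1 by rewrite ltr_wpDl.
  have [n] := half_lt (divr_gt0 ltr01 M1).
  rewrite div1r exprVn ltf_pV2 ?posrE ?exprn_gt0// => hn; exists n.
  by apply: Ple PM _; rewrite (le_trans _ (ltW hn))// lerDl.
pose B : K := 2 ^+ n + 2 ^+ n.
have B0 : 0 < B by rewrite addr_gt0 ?exprn_gt0.
have near0 y (e : K) : `|y| < r -> 0 < e -> exists2 z, P z B & `|y - z| < e.
  move=> yr e0; have e2 := divr_gt0 e0 two_gt0.
  have [||z1 Pz1 h1] := arP (y + a) _ (e / 2) => //; first by rewrite addrK.
  have [||z2 Pz2 h2] := arP a _ (e / 2) => //; first by rewrite subrr normr0.
  exists (z1 - z2); first exact: PB.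
  have -> : y - (z1 - z2) = (y + a - z1) - (a - z2).
    by rewrite !opprB [z2 - a]addrC addrACA addrK [- z1 + _]addrC.
  by rewrite (le_lt_trans (ler_normB _ _))// [e]splitr ltrD.
have step (s : nat * E) : exists z, `|s.2| < r * 2^-1 ^+ s.1 ->
    P z (B * 2^-1 ^+ s.1) /\ `|s.2 - z| < r * 2^-1 ^+ s.1.+1.
  case: s => k y /=; have h0 := half_gt0 K k.
  have [yr|?] := pselect (`|y| < r * 2^-1 ^+ k); last by exists 0.
  have [||z Pz yz] := near0 ((2^-1 ^+ k)^-1 *: y) (r / 2).
  - by rewrite normrZ normfV (gtr0_norm h0) mulrC ltr_pdivrMr.
  - exact: divr_gt0.
  exists (2^-1 ^+ k *: z) => _; split.
    by rewrite mulrC -{2}(gtr0_norm h0); exact: PZ.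
  rewrite -[y](scalerKV (lt0r_neq0 h0)) -scalerBr normrZ (gtr0_norm h0).
  by rewrite exprSr mulrCA ltr_pM2l.
have [nxt nxtP] := choice step.
have small x : `|x| < r -> P x (2 * B).
  move=> xr; pose fix y k := if k is k'.+1 then y k' - nxt (k', y k') else x.
  have yr k : `|y k| < r * 2^-1 ^+ k.
    elim: k => [|k IH]; first by rewrite expr0 mulr1.
    by have [] := nxtP (k, y k) IH.
  apply: (Psum (fun k => nxt (k, y k))); first exact: ltW.
    by move=> k; have [] := nxtP (k, y k) (yr k).
  have sy k : series (fun k => nxt (k, y k)) k = x - y k.
    elim: k => [|k IH]; first by rewrite /series /= big_geq// subrr.
    by rewrite seriesSr IH /= opprB addrCA addrC -addrA.
  apply/cvgn_leP => e e0; have [N hN] := half_small (ltW r0) e0; exists N => k Nk.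
  by rewrite sy opprB addrC subrK (le_trans (ltW (yr k)))// hN.
exists (2 * (2 * B) / r); first by rewrite !(divr_gt0, mulr_gt0).
move=> x; have [->|x0] := eqVneq x 0.
  have [M M0 PM] := Pex 0; have := PZ 0 _ _ PM.
  by rewrite !normr0 mul0r scaler0 mulr0.
have nx0 : 0 < `|x| by rewrite normr_gt0.
have t0 : 0 < r / (2 * `|x|) by rewrite divr_gt0// mulr_gt0.
have -> : x = (r / (2 * `|x|))^-1 *: ((r / (2 * `|x|)) *: x).
  by rewrite scalerK// lt0r_neq0.
have -> : 2 * (2 * B) / r * `|(r / (2 * `|x|))^-1 *: ((r / (2 * `|x|)) *: x)|
    = `|(r / (2 * `|x|))^-1| * (2 * B).
  rewrite scalerK ?lt0r_neq0// normfV gtr0_norm// invf_div.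
  by ring.
apply/PZ/small; rewrite normrZ gtr0_norm// invfM mulrA mulfVK ?lt0r_neq0//.
by rewrite gtr_pMr// invf_lt1// ltr1n.
Qed.

End Baire.

(** Zabreiko's lemma for the quotient norm [y |-> inf {|x| : T x = y}]. *)
Theorem open_mapping (K : scalarFieldType) (E F : normedModType K)
    (T : {linear E -> F}) : geo_complete E -> geo_complete F ->
  bounded_op T -> surjective T ->
  exists2 C : K, 0 < C & forall y, exists2 x, T x = y & `|x| <= C * `|y|.
Proof.
move=> Ec Fc Tb Ts.
apply: (zabreiko Fc (P := fun y M => exists2 x, T x = y & `|x| <= M)).
- by move=> y; have [x Tx] := Ts y; exists `|x| => //; exists x.
- by move=> y M N [x Tx xM] MN; exists x => //; exact: le_trans MN.
- move=> y y' M N [x <- xM] [x' <- xN]; exists (x - x'); first exact: linearB.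
  by rewrite (le_trans (ler_normB _ _))// lerD.
- move=> a y M [x <- xM]; exists (a *: x); first exact: linearZ.
  by rewrite normrZ ler_wpM2l.
move=> u y M M0 uM uy.
have /choice[x xP] : forall k, exists x, T x = u k /\ `|x| <= M * 2^-1 ^+ k.
  by move=> k; have [x] := uM k; exists x.
have Tx k : T (x k) = u k by have [] := xP k.
have xM k : `|x k| <= M * 2^-1 ^+ k by have [] := xP k.
have dx n : `|series x n.+1 - series x n| <= M * 2^-1 ^+ n.
  by rewrite seriesSB.
have [l xl] := Ec _ _ dx.
exists l; last first.
  have := geo_cvg_dist dx 0%N xl.
  by rewrite /series /= big_geq// sub0r normrN expr0 mulr1 mulrC.
apply: cvgn_uniq (bounded_op_cvg Tb xl) _.
rewrite (_ : T \o series x = series u)//; apply/funext => n /=.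
by rewrite op_series; congr (series _ n); apply/funext => k /=.
Qed.

(** * The Hahn-Banach theorem *)

(** Functionals defined on a subspace are handled as linear relations: such a
    relation is a function as soon as it is dominated by a sublinear functional,
    and inclusion is the order to which Zorn's lemma applies. *)
Definition linear_rel (K : numFieldType) (V : lmodType K) (G : set (V * K)) :=
  G (0, 0) /\ forall t x y a b,
    G (x, a) -> G (y, b) -> G (t *: x + y, t * a + b).

Definition hahn_banach_ext (K : scalarFieldType) : Prop :=
  forall (E : normedModType K) (G : set (E * K)) (M : K), 0 <= M ->
    linear_rel G -> (forall x a, G (x, a) -> `|a| <= M * `|x|) ->
  exists2 phi : dual E, (forall x a, G (x, a) -> phi x = a) & `|phi| <= M.

Section RealHahnBanach.
Variables (R : realType) (V : lmodType R) (p : V -> R).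
Implicit Types G : set (V * R).
Hypothesis pD : forall x y, p (x + y) <= p x + p y.
Hypothesis pZ : forall (t : R) x, 0 < t -> p (t *: x) = t * p x.

Definition dominated G := forall x a, G (x, a) -> a <= p x.

Let relZ G t x a : linear_rel G -> G (x, a) -> G (t *: x, t * a).
Proof. by move=> [G0 GL] Gx; have := GL t _ _ _ _ Gx G0; rewrite !addr0. Qed.

(** A value [c] at [x0] is admissible if it separates the numbers
    [a - p (y - x0)] from the numbers [p (y + x0) - a]. *)
Lemma hahn_banach_step G x0 : linear_rel G -> dominated G ->
  exists c : R, exists2 G' : set (V * R), G' (x0, c) &
    [/\ G `<=` G', linear_rel G' & dominated G'].
Proof.
move=> lG dG; have [G0 GL] := lG.
pose S := [set ya.2 - p (ya.1 - x0) | ya in G].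
have S0 : S !=set0 by exists (0 - p (0 - x0)), (0, 0).
have Sub y a : G (y, a) -> ubound S (p (y + x0) - a).
  move=> Gya _ [[z b] Gzb <-] /=; rewrite lerBlDr addrAC lerBrDr.
  have := dG _ _ (GL 1 _ _ _ _ Gzb Gya); rewrite scale1r mul1r => /le_trans; apply.
  have -> : z + y = (y + x0) + (z - x0) by rewrite addrACA subrr addr0 addrC.
  exact: pD.
have cge y a : G (y, a) -> a - sup S <= p (y - x0).
  move=> Gya; rewrite lerBlDl -lerBlDr; apply: ub_le_sup; last by exists (y, a).
  by exists (p (0 + x0) - 0); exact: Sub.
have cle y a : G (y, a) -> a + sup S <= p (y + x0).
  by move=> Gya; rewrite -lerBrDl; apply: ge_sup => //; exact: Sub.
exists (sup S).
exists [set xa | exists t y a, G (y, a) /\ xa = (y + t *: x0, a + t * sup S)].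
  by exists 1, 0, 0; rewrite scale1r mul1r !add0r.
split.
- by move=> [y a] Gya; exists 0, y, a; rewrite scale0r mul0r !addr0.
- split; first by exists 0, 0, 0; rewrite scale0r mul0r !addr0.
  move=> t _ _ _ _ [s [y [a [Gy [-> ->]]]]] [s' [y' [a' [Gy' [-> ->]]]]].
  exists (t * s + s'), (t *: y + y'), (t * a + a'); split; first exact: GL.
  congr pair; first by rewrite scalerDr scalerDl scalerA addrACA.
  by ring.
move=> _ _ [t [y [a [Gya [-> ->]]]]].
have [t0|t0|->] := ltrgtP t 0; last by rewrite scale0r mul0r !addr0; exact: dG.
  have s0 : 0 < - t by rewrite oppr_gt0.
  have := cge _ _ (relZ (- t)^-1 lG Gya); rewrite -(ler_pM2l s0) -pZ//.
  rewrite mulrBr scalerBr mulVKf ?scalerKV ?lt0r_neq0// mulNr scaleNr !opprK.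
  by [].
have := cle _ _ (relZ t^-1 lG Gya); rewrite -(ler_pM2l t0) -pZ//.
by rewrite mulrDr scalerDr mulVKf ?scalerKV ?lt0r_neq0.
Qed.

Theorem real_hahn_banach (G : set (V * R)) : linear_rel G -> dominated G ->
  exists g : V -> R, [/\ forall t x y, g (t *: x + y) = t * g x + g y,
    forall x, g x <= p x & forall x a, G (x, a) -> g x = a].
Proof.
move=> lG dG.
pose P := [set A | linear_rel (A `|` G) /\ dominated (A `|` G)].
have [F FP Ftot|A [[lA dA] Amax]] := @Zorn_bigcup _ P.
  (* two elements of a chain of relations lie in a common one *)
  have common u v : ((\bigcup_(X in F) X) `|` G) u ->
      ((\bigcup_(X in F) X) `|` G) v ->
      exists A, [/\ P A, (A `|` G) u, (A `|` G) v &
        A `|` G `<=` (\bigcup_(X in F) X) `|` G].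
    have P0 : P set0 by rewrite /P /= set0U.
    have sub A : F A -> A `|` G `<=` (\bigcup_(X in F) X) `|` G.
      by move=> FA w [Aw|Gw]; [left; exists A|right].
    move=> [[A FA Au]|Gu] [[B FB Bv]|Gv].
    - have [AB|BA] := Ftot A B FA FB.
        by exists B; split; [exact: FP|left; exact: AB|left|exact: sub].
      by exists A; split; [exact: FP|left|left; exact: BA|exact: sub].
    - by exists A; split; [exact: FP|left|right|exact: sub].
    - by exists B; split; [exact: FP|right|left|exact: sub].
    - by exists set0; split=> //; [right|right|rewrite set0U; exact: subsetUr].
  split.
    split; first by right; case: lG.
    move=> t x y a b xa yb; have [A [[[_ AL] _] Au Av]] := common _ _ xa yb.
    by apply; exact: AL.
  move=> x a xa; have [A [[_ dA] Au _ _]] := common _ _ xa xa.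
  exact: dA.
have [H0 HL] := lA.
have tot x : exists a, (A `|` G) (x, a).
  have [c [G' G'x [AG' lG' dG']]] := hahn_banach_step x lA dA.
  have GG' : G' `|` G = G'.
    by apply/setUidPl => z Gz; apply: AG'; right.
  exists c; apply: contrapT => nx; apply: (Amax G'); last first.
    by rewrite /P /= GG'.
  split; first by move=> z Az; apply: AG'; left.
  by move=> /(_ _ G'x) Ax; apply: nx; left.
have p0 : p 0 <= 0.
  have := pZ 0 (ltr0n R 2); rewrite scaler0.
  by move/esym/eqP; rewrite mulr_natl mulr2n -subr_eq0 addrK => /eqP->.
have fct x a b : (A `|` G) (x, a) -> (A `|` G) (x, b) -> a <= b.
  move=> xa xb; rewrite -subr_le0 (le_trans _ p0)//.
  have := dA _ _ (HL (-1) _ _ _ _ xb xa).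
  by rewrite scaleN1r mulN1r addNr [- b + a]addrC.
have [g gP] := choice tot.
exists g; split.
- move=> t x y; apply: le_anti; apply/andP; split.
    by apply: fct (gP _) _; exact: HL.
  by apply: fct _ (gP _); exact: HL.
- by move=> x; apply: dA.
- move=> x a xa; apply: le_anti; apply/andP.
  by split; [apply: fct (gP _) _; right|apply: fct _ (gP _); right].
Qed.

End RealHahnBanach.

Lemma real_hahn_banach_ext (R : realType) : hahn_banach_ext (R : scalarFieldType).
Proof.
move=> E G M M0 lG dG.
have [g [gl gp gG]] : exists g : E -> R,
    [/\ forall t x y, g (t *: x + y) = t * g x + g y,
    forall x, g x <= M * `|x| & forall x a, G (x, a) -> g x = a].
  apply: real_hahn_banach lG _.
  - by move=> x y; rewrite -mulrDr ler_wpM2l// ler_normD.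
  - by move=> t x t0; rewrite normrZ gtr0_norm// mulrCA.
  - by move=> x a /dG; apply: le_trans; exact: ler_norm.
have gM x : `|g x| <= M * `|x|.
  rewrite ler_norml gp andbT lerNl -normrN.
  suff <- : g (- x) = - g x by exact: gp.
  have g0 : g 0 = 0 by have [/gG] := lG.
  by rewrite -[- x]addr0 -scaleN1r gl g0 addr0 mulN1r.
have gd : (g : E -> R^o) \in @dual_pred (R : scalarFieldType) E.
  by apply/asboolP; split; [exact: gl|exists M => x _; exact: gM].
by exists (Dual gd) => //; exact: dual_norm_le.
Qed.

Section Realify.
Variables (R : realType) (E : lmodType R[i]).

(** An alias, so that real scaling does not compete with complex scaling. *)
Definition realify : Type := E.

HB.instance Definition _ := GRing.Zmodule.on realify.

Definition real_scale (t : R) (x : realify) : realify := (t%:C%C : R[i]) *: (x : E).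

Lemma real_scaleA s t x : real_scale s (real_scale t x) = real_scale (s * t) x.
Proof. by rewrite /real_scale scalerA -rmorphM. Qed.

Lemma real_scale1 : left_id 1 real_scale.
Proof. by move=> x; rewrite /real_scale scale1r. Qed.

Lemma real_scaleDr : right_distributive real_scale +%R.
Proof. by move=> t x y; rewrite /real_scale scalerDr. Qed.

Lemma real_scaleDl x : {morph real_scale^~ x : s t / s + t}.
Proof. by move=> s t; rewrite /real_scale rmorphD scalerDl. Qed.

HB.instance Definition _ := GRing.Zmodule_isLmodule.Build R realify
  real_scaleA real_scale1 real_scaleDr real_scaleDl.

End Realify.

Section ComplexHahnBanach.
Variable R : realType.
Local Notation Re := complex.Re.
Local Notation Im := complex.Im.

Lemma lec_Re (x y : R[i]) : x <= y -> Re x <= Re y.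
Proof. by rewrite lecE => /andP[]. Qed.

Lemma Re_le_norm (z : R[i]) : Re z <= Re `|z|.
Proof. exact: le_trans (ler_norm _) (lec_Re (normc_ge_Re z)). Qed.

(** The real theorem extends the real part [u] of the given functional, and a
    complex functional is recovered from its real part as
    [x |-> u x - i u (i x)]. The bound passes from [u] to it by rotating [x] so
    that the value at [x] becomes real. *)
Lemma complex_hahn_banach_ext : hahn_banach_ext (R[i] : scalarFieldType).
Proof.
move=> E G M M0 lG dG; have [G0 GL] := lG.
have nR (x : E) : (Re (M * `|x|))%:C%C = M * `|x|.
  by apply/RRe_real/ger0_real; rewrite mulr_ge0.
have MR : (Re M)%:C%C = M by exact/RRe_real/ger0_real.
have [u [ul up uG]] : exists u : realify E -> R,
    [/\ forall t x y, u (t *: x + y) = t * u x + u y,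
    forall x, u x <= Re (M * `|x : E|) &
    forall x a, [set xa : realify E * R |
      exists2 b, G (xa.1, b) & xa.2 = Re b] (x, a) -> u x = a].
  apply: real_hahn_banach.
  - move=> x y; rewrite -raddfD/=; apply: lec_Re.
    by rewrite -mulrDr ler_wpM2l// ler_normD.
  - move=> t x t0; apply: complexI; rewrite rmorphM /= !nR.
    by rewrite [_ *: _]/(real_scale t x) normrZ gtr0_norm ?ltcR// mulrCA.
  - split; first by exists 0.
    move=> t x y _ _ [a /= Ga ->] [b /= Gb ->]; exists (t%:C%C * a + b).
      exact: GL.
    by rewrite raddfD /=; case: a {Ga} => a1 a2 /=; rewrite mul0r subr0.
  - move=> x _ [b /= Gb ->]; apply: (le_trans (Re_le_norm b)).
    exact/lec_Re/dG.
have uD x y : u (x + y) = u x + u y by have := ul 1 x y; rewrite scale1r mul1r.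
have u0 : u 0 = 0 by apply: uG; exists 0.
have uZ (t : R) (x : E) : u (t%:C%C *: x) = t * u x.
  by have := ul t x 0; rewrite u0 !addr0.
pose g (x : E) : R[i] := (u x)%:C%C - 'i%C * (u ('i%C *: x))%:C%C.
have gD x y : g (x + y) = g x + g y.
  by rewrite /g scalerDr !uD !rmorphD /=; ring.
have gR (t : R) x : g (t%:C%C *: x) = t%:C%C * g x.
  rewrite /g.
  have -> : 'i%C *: (t%:C%C *: x) = t%:C%C *: ('i%C *: x).
    by rewrite !scalerA mulrC.
  by rewrite !uZ !rmorphM /=; ring.
have gi x : g ('i%C *: x) = 'i%C * g x.
  have ii : 'i%C * 'i%C = -1 :> R[i] by rewrite -expr2 sqr_i.
  rewrite /g scalerA ii mulrBr mulrA ii (_ : -1 = (-1)%:C%C :> R[i]); last first.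
    by rewrite rmorphN1.
  by rewrite uZ rmorphM rmorphN1 /=; ring.
have gl : linear (g : E -> R[i]^o).
  move=> z x y; rewrite gD; congr (_ + _).
  by rewrite [in LHS](complexE z) scalerDl -scalerA gD gi !gR mulrA -mulrDl -complexE.
have gRe x : Re (g x) = u x.
  by rewrite /g raddfB /= !mul0r mul1r subr0 subr0.
have gM x : `|g x| <= M * `|x|.
  have [->|gx0] := eqVneq (g x) 0; first by rewrite normr0 mulr_ge0.
  have ngx : `|g x| != 0 by rewrite normr_eq0.
  pose z := (g x)^*%C / `|g x|.
  have z1 : `|z| = 1 by rewrite normrM normfV normr_id normcJ divff.
  have gz : g (z *: x) = `|g x|.
    have g0 : g 0 = 0 by rewrite /g scaler0 u0 rmorph0 mulr0 subr0.
    rewrite -[z *: x]addr0 gl g0 addr0 -[_ *: _]/(z * g x).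
    by rewrite /z mulrAC [_^*%C * _]mulrC -sqr_normc expr2 mulfK.
  rewrite -gz -(RRe_real (x := g (z *: x))) ?gz ?normr_real// -gz gRe.
  rewrite -[`|x|]mul1r -z1 -normrZ -nR lecR; exact: up.
have gd : (g : E -> R[i]^o) \in @dual_pred (R[i] : scalarFieldType) E.
  by apply/asboolP; split; [exact: gl|exists M => x _; exact: gM].
exists (Dual gd); last exact: dual_norm_le.
move=> x a Ga; rewrite /= /g (uG x (Re a)); last by exists a.
rewrite (uG ('i%C *: x) (Re ('i%C * a))); last first.
  by exists ('i%C * a) => //; have := GL 'i%C _ _ _ _ Ga G0; rewrite !addr0.
by rewrite ['i%C * a]mulrC ReiNIm rmorphN mulrN opprK -complexE.
Qed.

End ComplexHahnBanach.

(** * Completeness of the scalars *)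

Lemma real_geo_complete (R : realType) : geo_complete (R^o : normedModType R).
Proof. exact: (@complete_geo (R : scalarFieldType) R^o). Qed.

Lemma complex_geo_complete (R : realType) :
  geo_complete (R[i]^o : normedModType R[i]).
Proof.
move=> u M uM; have M0 := geo_bound_ge0 (K := R[i]) uM.
have MR : (complex.Re M)%:C%C = M by exact/RRe_real/ger0_real.
have norm_i : `|'i%C : R[i]| = 1.
  by rewrite normc_def /= expr0n expr1n add0r sqrtr1.
have Im_le (z : R[i]) : `|complex.Im z|%:C%C <= `|z|.
  have -> : complex.Im z = complex.Re (- ('i%C * z)).
    by rewrite raddfN /= mulrC ReiNIm opprK.
  by rewrite (le_trans (normc_ge_Re _))// normrN normrM norm_i mul1r.
have part (f : {additive R[i] -> R}) : (forall z, `|f z|%:C%C <= `|z|) ->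
    exists l : R, forall e : R, 0 < e ->
      exists N, forall n, (N <= n)%N -> `|l - f (u n)| <= e.
  move=> fle; have [|l /cvgn_leP fl] :=
    @real_geo_complete R (f \o u) (complex.Re M); last by exists l.
  move=> n; rewrite /= -raddfB -lecR (le_trans (fle _))// (le_trans (uM n))//.
  by rewrite rmorphM rmorphXn /= MR fmorphV rmorph_nat.
have [a ua] := part (@complex.Re R : {additive R[i] -> R}) (@normc_ge_Re R).
have [b ub] := part (@complex.Im R : {additive R[i] -> R}) Im_le.
exists (a +i* b)%C; apply/cvgn_leP => e e0.
have eR : (complex.Re e)%:C%C = e by exact/RRe_real/gtr0_real.
have e2 : 0 < complex.Re e / 2 by rewrite divr_gt0// -ltcR eR.
have [N hN] := ua _ e2; have [N' hN'] := ub _ e2.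
exists (maxn N N') => n; rewrite geq_max => /andP[Nn N'n].
rewrite [X in `|X|]complexE (le_trans (ler_normD _ _))// normrM.
have rn (t : R) : `|t%:C%C| = `|t|%:C%C :> R[i].
  by rewrite normc_def /= expr0n addr0 sqrtr_sqr.
rewrite norm_i mul1r !rn -rmorphD -eR lecR [complex.Re e]splitr.
by case: (u n) (hN n Nn) (hN' n N'n) => x y /= *; rewrite lerD.
Qed.

(** * Dual spaces *)

HB.instance Definition _ (K : scalarFieldType) (E : normedModType K)
    (phi : dual E) :=
  GRing.isLinear.Build K E K^o *:%R phi (dual_linear phi).

Section Dual.
Variables (K : scalarFieldType) (E : normedModType K).
Implicit Types (phi psi : dual E) (x : E).

Lemma dual_ext phi psi : (forall x, phi x = psi x) -> phi = psi.
Proof. by move=> e; apply/val_inj/funext. Qed.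

Lemma ler_dual phi x : `|phi x| <= `|phi| * `|x|.
Proof. exact: le_dual_norm. Qed.

Lemma dual_ex (f : E -> K^o) (M : K) : 0 <= M -> linear f ->
  (forall x, `|f x| <= M * `|x|) ->
  exists2 phi : dual E, (forall x, phi x = f x) & `|phi| <= M.
Proof.
move=> M0 fl fM; have fd : f \in @dual_pred K E.
  by apply/asboolP; split=> //; exists M => x _; exact: fM.
by exists (Dual fd) => //; exact: dual_norm_le.
Qed.

Lemma dual_cvg phi u l : u @ \oo --> l -> phi \o u @ \oo --> phi l.
Proof. exact/bounded_op_cvg/dual_bounded. Qed.

Lemma dual_geo_complete :
  geo_complete (K^o : normedModType K) -> geo_complete (dual E).
Proof.
move=> Kc u M uM; have M0 := geo_bound_ge0 uM.
have ux x n : `|u n.+1 x - u n x| <= M * `|x| * 2^-1 ^+ n.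
  rewrite mulrAC (le_trans (ler_dual (u n.+1 - u n) x))// ler_wpM2r//.
have /choice[f uf] : forall x, exists l : K^o, (fun n => u n x) @ \oo --> l.
  by move=> x; exact: Kc (ux x).
have fl : linear f.
  move=> a x y; apply: (cvgn_uniq (uf _)).
  rewrite (_ : (fun n => _) = (fun n => a *: u n x + u n y)); last first.
    by apply/funext => n; rewrite linearP.
  by apply: cvgD; [apply: cvgZl_tmp; exact: uf|exact: uf].
have dist x n : `|u n x - f x| <= M * 2 * 2^-1 ^+ n * `|x|.
  have -> : M * 2 * 2^-1 ^+ n * `|x| = M * `|x| * 2 * 2^-1 ^+ n by ring.
  exact: (geo_cvg_dist (ux x) n (uf x)).
have [|||phi phiE _] := @dual_ex f (`|u 0%N| + M * 2).
- by rewrite addr_ge0 ?mulr_ge0.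
- exact: fl.
- move=> x; rewrite -[f x](subKr (u 0%N x)) mulrDl (le_trans (ler_normB _ _))//.
  by rewrite lerD ?ler_dual//; have := dist x 0%N; rewrite expr0 mulr1.
exists phi; apply/cvgn_leP => e e0.
have [|N hN] := @half_small K (M * 2) e _ e0; first by rewrite mulr_ge0.
exists N => n Nn; apply: le_trans (hN n Nn); rewrite distrC.
apply: dual_norm_le; first by rewrite !mulr_ge0// ltW// half_gt0.
by move=> x; rewrite [X in `|X|](_ : _ = u n x - f x)// -phiE.
Qed.

Lemma bidual_embE x phi : bidual_emb x phi = phi x.
Proof. by []. Qed.

End Dual.

Section LinSpan.
Variables (K : numFieldType) (E : lmodType K) (u : nat -> E).

Lemma lin_spanE (c : nat -> K) n m : (n <= m)%N ->
  \sum_(0 <= i < n) c i *: u i =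
  \sum_(0 <= i < m) (if (i < n)%N then c i else 0) *: u i.
Proof.
move=> nm; rewrite (big_nat_widen _ _ _ _ _ nm) big_mkcond /=.
by apply: eq_bigr => i _; case: ifP => // _; rewrite scale0r.
Qed.

Lemma lin_span_lin a x y :
  lin_span u x -> lin_span u y -> lin_span u (a *: x + y).
Proof.
move=> [n [c ->]] [m [d ->]].
exists (maxn n m), (fun i => a * (if (i < n)%N then c i else 0) +
  (if (i < m)%N then d i else 0)).
rewrite (lin_spanE c (leq_maxl n m)) (lin_spanE d (leq_maxr n m)).
rewrite scaler_sumr -big_split /=; apply: eq_bigr => i _.
by rewrite scalerA scalerDl.
Qed.

Lemma lin_span0 : lin_span u 0.
Proof. by exists 0%N, (fun=> 0); rewrite big_geq. Qed.

Lemma lin_span_gen i : lin_span u (u i).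
Proof.
exists i.+1, (fun j => (j == i)%:R).
rewrite big_nat_recr//= eqxx scale1r big_nat_cond big1 ?add0r// => j.
by case/andP => /andP[_ /ltn_eqF->]; rewrite scale0r.
Qed.

Lemma lin_span_series c n : lin_span u (series (fun i => c i *: u i) n).
Proof. by exists n, c. Qed.

End LinSpan.

Section HahnBanachConsequences.
Variables (K : scalarFieldType) (HB : hahn_banach_ext K).

Lemma norming (E : normedModType K) (x : E) :
  exists2 phi : dual E, phi x = `|x| & `|phi| <= 1.
Proof.
pose G := [set xa : E * K | exists t, xa = (t *: x, t * `|x|)].
have [||phi phiG phi1] := HB (G := G) (M := 1) ler01.
- split; first by exists 0; rewrite scale0r mul0r.
  move=> t _ _ _ _ [s [-> ->]] [s' [-> ->]]; exists (t * s + s').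
  by rewrite scalerA scalerDl mulrA mulrDl.
- move=> _ _ [t [-> ->]].
  by rewrite mul1r normrZ normrM normr_id.
exists phi => //; apply: phiG.
by exists 1; rewrite scale1r mul1r.
Qed.

Lemma norm_bidual_emb (E : normedModType K) (x : E) : `|bidual_emb x| = `|x|.
Proof.
apply: le_anti; apply/andP; split.
  apply: dual_norm_le => // f; rewrite bidual_embE mulrC.
  exact: ler_dual.
have [phi phix phi1] := norming x.
have := ler_dual (bidual_emb x) phi.
rewrite bidual_embE phix normr_id => /le_trans; apply.
by rewrite ler_piMr.
Qed.

Lemma dual_separates (E : normedModType K) (x y : E) :
  (forall phi : dual E, phi x = phi y) -> x = y.
Proof.
move=> e; have [phi + _] := norming (x - y).
by rewrite linearB /= e subrr => /esym/eqP; rewrite normr_eq0 subr_eq0 => /eqP.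
Qed.

Lemma bidual_embK (E : normedModType K) : cancel (@bidual_emb K E) (@bidual_inv K E).
Proof.
move=> x; apply: dual_separates => phi.
have /(_ _) e := @xgetPex _ 0 [set y | bidual_emb y = bidual_emb x].
by have /(congr1 (fun G : dual (dual E) => G phi)) := e (ex_intro _ x erefl).
Qed.

Lemma bidual_invK (E : normedModType K) : reflexive_space E ->
  cancel (@bidual_inv K E) (@bidual_emb K E).
Proof. by move=> Er G; have [x <-] := Er G; rewrite bidual_embK. Qed.

(** A vector at positive distance from the span is moved to [1] by a functional
    that vanishes on the span. *)
Lemma span_dense (E : normedModType K) (u : nat -> E) :
  (forall phi : dual E, (forall i, phi (u i) = 0) -> phi = 0) ->
  forall v (e : K), 0 < e -> exists2 w, lin_span u w & `|v - w| < e.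
Proof.
move=> utot v e e0; apply: contrapT => far.
have {}far w : lin_span u w -> e <= `|v - w|.
  move=> uw; rewrite real_leNgt ?normr_real ?gtr0_real//.
  by apply/negP => vw; apply: far; exists w.
pose G := [set xa : E * K | exists t w, lin_span u w /\ xa = (t *: v - w, t)].
have [|||phi phiG _] := HB (G := G) (M := e^-1); first by rewrite invr_ge0 ltW.
- split; first by exists 0, 0; rewrite scale0r subr0; split=> //; exact: lin_span0.
  move=> t _ _ _ _ [s [w [uw [-> ->]]]] [s' [w' [uw' [-> ->]]]].
  exists (t * s + s'), (t *: w + w'); split; first exact: lin_span_lin.
  by rewrite scalerDl scalerBr scalerA opprD addrACA.
- move=> _ _ [t [w [uw [-> ->]]]]; rewrite ler_pdivlMl//.
  have [->|t0] := eqVneq t 0; first by rewrite normr0 mulr0.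
  rewrite -[w](scalerKV t0) -scalerBr normrZ mulrC ler_wpM2l//.
  by apply: far; rewrite -[_ *: w]addr0; apply: lin_span_lin => //; exact: lin_span0.
have phi0 : phi = 0.
  apply: utot => i; apply: phiG; exists 0, (- u i); rewrite scale0r sub0r opprK.
  split=> //; rewrite -scaleN1r -[_ *: _]addr0.
  by apply: lin_span_lin; [exact: lin_span_gen|exact: lin_span0].
have : phi v = 1.
  by apply: phiG; exists 1, 0; rewrite scale1r subr0; split=> //; exact: lin_span0.
by rewrite phi0 => /esym/eqP; rewrite oner_eq0.
Qed.

(** Half of the closed range theorem: [F] is carried to the range of [U], where
    it is bounded, and extended from there. *)
Lemma bounded_below_surj (E F : normedModType K) (U : {linear E -> F}) (A : K) :
  0 < A -> (forall x, A * `|x| <= `|U x|) ->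
  forall phi : dual E, exists V : dual F, forall x, V (U x) = phi x.
Proof.
move=> A0 UA phi.
pose G := [set ya : F * K | exists x, ya = (U x, phi x)].
have [|||V VG _] := HB (G := G) (M := `|phi| / A).
- by rewrite divr_ge0// ltW.
- split; first by exists 0; rewrite !linear0.
  move=> t _ _ _ _ [x [-> ->]] [y [-> ->]]; exists (t *: x + y).
  by rewrite !linearP.
- move=> _ _ [x [-> ->]]; rewrite (le_trans (ler_dual _ _))// -mulrA.
  by rewrite ler_wpM2l// ler_pdivlMl.
by exists V => x; apply: VG; exists x.
Qed.

(** The converse half: by the open mapping theorem a functional norming [x] is
    [V] composed with [U], for some [V] of norm at most a constant. *)
Lemma surj_bounded_below (E F : normedModType K) (U : E -> F)
    (T : {linear dual F -> dual E}) : geo_complete (K^o : normedModType K) ->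
  (forall V x, T V x = V (U x)) -> bounded_op T -> surjective T ->
  exists2 A : K, 0 < A & forall x, A * `|x| <= `|U x|.
Proof.
move=> Kc TU Tb Ts; have [||C C0 TC] := open_mapping _ _ Tb Ts.
- exact: dual_geo_complete.
- exact: dual_geo_complete.
exists C^-1 => [|x]; first by rewrite invr_gt0.
have [phi phix phi1] := norming x; have [V TV VC] := TC phi.
rewrite ler_pdivrMl// -[`|x|]normr_id -phix -TV TU.
rewrite (le_trans (ler_dual _ _))// ler_wpM2r// (le_trans VC)//.
by rewrite ler_piMr// ltW.
Qed.

Lemma precomp_ex (E F : normedModType K) (U : {linear E -> F}) : bounded_op U ->
  exists2 T : {linear dual F -> dual E}, bounded_op T &
    forall V x, T V x = V (U x).
Proof.
move=> /bounded_op_gt0[M M0 UM].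
have /choice[f fP] : forall V : dual F, exists W : dual E,
    (forall x, W x = V (U x)) /\ `|W| <= M * `|V|.
  move=> V.
  have [|||W WE WM] := @dual_ex K E (V \o U) (M * `|V|).
  - by rewrite mulr_ge0// ltW.
  - by move=> a x y /=; rewrite !linearP.
  - move=> x /=; rewrite (le_trans (ler_dual _ _))//.
    by rewrite [M * _]mulrC -mulrA ler_wpM2l.
  by exists W.
have fl : linear f.
  move=> a V W; apply: dual_ext => x; have [-> _] := fP (a *: V + W).
  rewrite [RHS](_ : _ = a *: f V x + f W x)//.
  by have [-> _] := fP V; have [-> _] := fP W.
pose T : {linear dual F -> dual E} := HB.pack f (GRing.isLinear.Build _ _ _ _ _ fl).
exists T; first by exists M => V _; have [] := fP V.
by move=> V; have [] := fP V.
Qed.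

End HahnBanachConsequences.

(** * Sequence spaces whose canonical vectors form a basis *)

Section Coordinates.
Variables (K : numFieldType) (Xd : seq_space K).

Definition ss_coord i (c : Xd) : K^o := ss_seq c i.

Lemma coord_linear i : linear (ss_coord i).
Proof. by move=> a x y; rewrite /ss_coord ss_linear. Qed.

HB.instance Definition _ i :=
  GRing.isLinear.Build K Xd K^o *:%R (ss_coord i) (coord_linear i).

Definition psum n (c : Xd) : Xd := series (fun i => ss_coord i c *: canon_vec Xd i) n.

Lemma psum_linear n : linear (psum n).
Proof.
move=> a x y; rewrite /psum /series /= scaler_sumr -big_split /=.
by apply: eq_bigr => i _; rewrite linearP scalerDl scalerA.
Qed.

HB.instance Definition _ n :=
  GRing.isLinear.Build K Xd Xd *:%R (psum n) (psum_linear n).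

Lemma psumS n c : psum n.+1 c = psum n c + ss_coord n c *: canon_vec Xd n.
Proof. by rewrite /psum seriesSr. Qed.

Lemma of_seqE (s : nat -> K) : seq_in Xd s -> ss_seq (of_seq Xd s) = s.
Proof. exact: (@xgetPex _ 0 [set c : Xd | ss_seq c = s]). Qed.

Lemma of_seqK (c : Xd) : of_seq Xd (ss_seq c) = c.
Proof. by apply: (@ss_inj _ Xd); rewrite of_seqE//; exists c. Qed.

End Coordinates.

Section Basis.
Variables (K : scalarFieldType) (Xd : seq_space K).
Hypothesis hXd : CB_space Xd.
Local Notation delta := (canon_vec Xd).

Lemma coord_delta i j : ss_coord i (delta j) = (i == j)%:R.
Proof. by have [h _ _] := hXd; rewrite /ss_coord of_seqE. Qed.

Lemma delta_neq0 i : delta i != 0.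
Proof.
apply/eqP => d0; have := coord_delta i i; rewrite d0 linear0 eqxx => /esym/eqP.
by rewrite oner_eq0.
Qed.

Lemma psum_cvg (c : Xd) : (fun n => psum n c) @ \oo --> c.
Proof. by have [_ _] := hXd; apply. Qed.

Lemma coord_psum i n (c : Xd) : ss_coord i (psum n c) = (i < n)%:R * ss_coord i c.
Proof.
elim: n => [|n IH]; first by rewrite /psum /series /= big_geq// linear0 mul0r.
rewrite psumS linearD linearZ /= IH coord_delta ltnS [in RHS]leq_eqVlt.
have [->|_] /= := eqVneq i n; last by rewrite scaler0 addr0.
by rewrite ltnn mul0r add0r !mul1r -[LHS]/(ss_coord n c * 1) mulr1.
Qed.

Lemma basis_uniq (b : nat -> K) (c : Xd) :
  series (fun i => b i *: delta i) @ \oo --> c -> b = ss_seq c.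
Proof.
move=> bc; have [_ sch _] := hXd; have [d [_ du]] := sch c.
by rewrite -(du _ bc) (du (ss_seq c) (@psum_cvg c)).
Qed.

(** Zabreiko's lemma for [c |-> sup_n |psum n c|]. Countable subadditivity: if the
    [u k] have geometrically small partial sums then so have their coordinates,
    which therefore add up to scalars [b i]; the expansion with coefficients [b]
    converges to the sum of the [u k] and must be its canonical expansion. *)
Lemma psum_bounded : geo_complete (K^o : normedModType K) ->
  exists2 C : K, 0 < C & forall (c : Xd) n, `|psum n c| <= C * `|c|.
Proof.
move=> Kc; have [|||||C C0 CP] := zabreiko (@complete_geo K Xd)
  (P := fun c M => forall n, `|psum n c| <= M); last by exists C.
- by move=> c; have [M M0 cM] := cvgn_bounded (@psum_cvg c); exists M.
- by move=> c M N cM MN n; exact: le_trans MN.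
- move=> c d M N cM dN n; rewrite linearB (le_trans (ler_normB _ _))//.
  exact: lerD (cM n) (dN n).
- by move=> a c M cM n; rewrite linearZ normrZ ler_wpM2l//; exact: cM.
move=> u x M M0 uM ux.
have coef_le i k : `|ss_coord i (u k)| <= 2 * M / `|delta i| * 2^-1 ^+ k.
  rewrite mulrAC ler_pdivlMr ?normr_gt0 ?delta_neq0// -normrZ.
  have -> : ss_coord i (u k) *: delta i = psum i.+1 (u k) - psum i (u k).
    by rewrite psumS addrC addKr.
  rewrite (le_trans (ler_normB _ _))// (le_trans (lerD (uM k i.+1) (uM k i)))//.
  by rewrite -mulr2n -[leLHS]mulr_natl mulrA.
have /choice[b ub] : forall i, exists l : K^o,
    (fun m => ss_coord i (series u m)) @ \oo --> l.
  move=> i; have [|l ul] := Kc (fun m => ss_coord i (series u m)) (2 * M / `|delta i|).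
    by move=> m; rewrite -raddfB seriesSB; exact: coef_le.
  by exists l.
pose B n : Xd := series (fun i => b i *: delta i) n.
have uB n : (fun m => psum n (series u m)) @ \oo --> B n.
  elim: n => [|n IH].
    have -> : (fun m => psum 0 (series u m)) = (fun=> B 0%N).
      by apply/funext => m; rewrite /psum /B /series /= !big_geq.
    exact: cvg_cst.
  have -> : (fun m => psum n.+1 (series u m)) =
      (fun m => psum n (series u m) + ss_coord n (series u m) *: delta n).
    by apply/funext => m; rewrite psumS.
  rewrite /B seriesSr; apply: cvgD => //.
  exact: cvgZr_tmp (ub n).
have dist n m : `|psum n (series u m) - B n| <= M * 2 * 2^-1 ^+ m.
  apply: (geo_cvg_dist _ _ (uB n)) => k.
  by rewrite -raddfB seriesSB; exact: uM.
have Bx : B @ \oo --> x.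
  apply/cvgn_leP => e e0; have e3 : 0 < e / 3 by rewrite divr_gt0.
  have [|N hN] := @half_small K (M * 2) _ _ e3; first by rewrite mulr_ge0.
  have /cvgn_leP/(_ _ e3)[N' hN'] := ux.
  pose m := maxn N N'.
  have /cvgn_leP/(_ _ e3)[N2 hN2] := @psum_cvg (series u m).
  exists N2 => n Nn.
  have -> : x - B n = (x - series u m) + (series u m - psum n (series u m))
     + (psum n (series u m) - B n) by rewrite !subrKA.
  have -> : e = e / 3 + e / 3 + e / 3 by field.
  rewrite (le_trans (ler_normD _ _))// lerD//; last first.
    by rewrite (le_trans (dist n m))// hN// leq_maxl.
  by rewrite (le_trans (ler_normD _ _))// lerD// ?hN2// hN'// leq_maxr.
move=> n; have -> : psum n x = B n by rewrite /psum /ss_coord -(basis_uniq Bx).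
have := dist n 0%N; rewrite expr0 mulr1 mulrC.
by rewrite [series u 0]/series /= big_geq// linear0 sub0r normrN.
Qed.

Section Dual.
Hypothesis Kc : geo_complete (K^o : normedModType K).

Lemma coord_bounded i : exists2 M : K, 0 <= M &
  forall c : Xd, `|ss_coord i c| <= M * `|c|.
Proof.
have [C C0 CP] := psum_bounded Kc; exists (2 * C / `|delta i|).
  by rewrite divr_ge0// mulr_ge0// ltW.
move=> c; rewrite mulrAC ler_pdivlMr ?normr_gt0 ?delta_neq0// -normrZ.
have -> : ss_coord i c *: delta i = psum i.+1 c - psum i c.
  by rewrite psumS addrC addKr.
rewrite (le_trans (ler_normB _ _))// (le_trans (lerD (CP c i.+1) (CP c i)))//.
by rewrite -mulr2n -[leLHS]mulr_natl mulrA.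
Qed.

Lemma dual_psum_cvg (V : dual Xd) (c : Xd) :
  series (fun i => ss_coord i c * V (delta i)) @ \oo --> (V c : K^o).
Proof.
have -> : series (fun i => ss_coord i c * V (delta i)) = V \o (fun n => psum n c).
  apply/funext => n /=; rewrite /psum op_series; apply: eq_bigr => i _ /=.
  by rewrite linearZ.
exact: dual_cvg (@psum_cvg c).
Qed.

Lemma dual_basis_ext (V W : dual Xd) :
  (forall i, V (delta i) = W (delta i)) -> V = W.
Proof.
move=> e; apply: dual_ext => c; apply: cvgn_uniq (@dual_psum_cvg V c) _.
have -> : (fun i => ss_coord i c * V (delta i)) = (fun i => ss_coord i c * W (delta i)).
  by apply/funext => i; rewrite e.
exact: dual_psum_cvg.
Qed.

Lemma dual_deltaE i (c : Xd) : dual_canon_vec Xd i c = ss_coord i c.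
Proof.
have [M M0 cM] := coord_bounded i.
have [W WE _] := dual_ex M0 (coord_linear i) cM.
have Wi : dual_seq W = unit_seq K i.
  by apply/funext => j; rewrite /dual_seq WE coord_delta /unit_seq eq_sym.
rewrite -WE; congr (dual_val _ c); apply: dual_basis_ext => j.
have := @xgetPex _ 0 [set V : dual Xd | dual_seq V = unit_seq K i] (ex_intro _ W Wi).
by rewrite -[RHS]/(dual_seq W j) Wi => /(congr1 (@^~ j)).
Qed.

(** The canonical basis of a reflexive [Xd] is shrinking: only [0] in [Xd^**] =
    [Xd] vanishes on all coordinate functionals, which therefore span a dense
    subspace; on it the expansions are eventually exact, and the partial sums
    are uniformly bounded. *)
Lemma dual_basis_cvg (V : dual Xd) : hahn_banach_ext K -> reflexive_space Xd ->
  series (fun i => V (delta i) *: dual_canon_vec Xd i) @ \oo --> V.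
Proof.
move=> HB Xr; have [C C0 CP] := psum_bounded Kc.
have psE (W : dual Xd) n c :
    series (fun i => W (delta i) *: dual_canon_vec Xd i) n c = W (psum n c).
  rewrite /psum op_series /series /=.
  elim: n => [|n IH]; first by rewrite !big_geq.
  rewrite !big_nat_recr//= linearZ -IH.
  by rewrite [LHS](_ : _ = (\sum_(0 <= i < n) W (delta i) *: dual_canon_vec Xd i) c
    + W (delta n) * dual_canon_vec Xd n c)// dual_deltaE mulrC.
apply/cvgn_leP => e e0.
have C1 : 0 < 1 + C by rewrite addr_gt0.
have [|_ [N [d ->]] Vw] := @span_dense K HB _ (dual_canon_vec Xd) _ V _ (divr_gt0 e0 C1).
  move=> G G0; have [c Gc] := Xr G.
  suff -> : G = bidual_emb 0.
    by apply: dual_ext => W; rewrite bidual_embE linear0.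
  rewrite -Gc; congr bidual_emb; apply: (@ss_inj _ Xd); apply/funext => i.
  have := G0 i; rewrite -Gc bidual_embE dual_deltaE => ci.
  by rewrite -![ss_seq _ _]/(ss_coord i _) ci linear0.
set w := \sum_(0 <= i < N) _ in Vw.
exists N => n Nn.
have wE (c : Xd) : w (psum n c) = w c.
  have wc (x : Xd) : w x = \sum_(0 <= i < N) d i * ss_coord i x.
    rewrite /w; elim: (N) => [|k IH]; first by rewrite !big_geq.
    rewrite !big_nat_recr//= -IH -dual_deltaE.
    by [].
  rewrite !wc; apply: eq_big_nat => i /andP[_ iN]; congr (_ * _).
  by rewrite coord_psum (leq_trans iN Nn) mul1r.
have VwE (x : Xd) : (V - w) x = V x - w x by [].
rewrite -[e](mulfVK (lt0r_neq0 C1)); apply: dual_norm_le.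
  by rewrite ltW// mulr_gt0// divr_gt0.
move=> c; rewrite [X in `|X|](_ : _ = V c -
  series (fun i => V (delta i) *: dual_canon_vec Xd i) n c)// psE.
have -> : V c - V (psum n c) = (V - w) c - (V - w) (psum n c).
  by rewrite !VwE wE opprB subrKA.
rewrite (le_trans (ler_normB _ _))// mulrDr mulr1 mulrDl lerD//.
  by rewrite (le_trans (ler_dual _ _))// ler_wpM2r// ltW.
rewrite (le_trans (ler_dual _ _))// -[leRHS]mulrA.
by apply: ler_pM => //; exact: ltW Vw.
Qed.

End Dual.
End Basis.

(** * Operators defined on a subspace *)

Lemma series_single (V : zmodType) (v : nat -> V) j n :
  (forall i, i != j -> v i = 0) -> (j < n)%N -> series v n = v j.
Proof.
move=> v0; elim: n => // n IH; rewrite ltnS leq_eqVlt seriesSr.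
case/predU1P => [jn|jn]; last by rewrite IH// (v0 n) ?addr0// gtn_eqF.
rewrite /series /= big_nat_cond big1 ?add0r ?jn// => i /andP[/andP[_ ij] _].
by rewrite v0// jn ltn_eqF.
Qed.

Section Operators.
Variables (K : scalarFieldType) (E F : normedModType K).
Implicit Types T : operator E F.

Lemma op0 T : T 0 = 0.
Proof.
by have := op_lin (o := T) (-1) (dom0 T) (dom0 T); rewrite !scaleN1r !addNr.
Qed.

Lemma op_lin_sum T (u : nat -> E) (c : nat -> K) n : (forall i, dom T (u i)) ->
  dom T (series (fun i => c i *: u i) n) /\
  T (series (fun i => c i *: u i) n) = series (fun i => c i *: T (u i)) n.
Proof.
move=> Tu; elim: n => [|n [IHd IHT]].
  by rewrite /series /= !big_geq//; split; [exact: dom0|exact: op0].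
rewrite !seriesSr ![_ + _ *: _]addrC; split; first exact: dom_lin.
by rewrite op_lin// IHT.
Qed.

Lemma adjointP T (phi : dual F) (psi : dual E) :
  (forall x, dom T x -> psi x = phi (T x)) ->
  forall x, dom T x -> adjoint T phi x = phi (T x).
Proof.
move=> psiP; apply: (@xgetPex _ 0
  [set psi : dual E | forall x, dom T x -> psi x = phi (T x)]).
by exists psi.
Qed.

Definition synth_dom (a : nat -> {linear E -> K^o}) (y : nat -> F) : set E :=
  [set x | cvgn (series (fun i => a i x *: y i))].

Variables (a : nat -> {linear E -> K^o}) (y : nat -> F).

Lemma synth_lin t x x' l l' :
  series (fun i => a i x *: y i) @ \oo --> l ->
  series (fun i => a i x' *: y i) @ \oo --> l' ->
  series (fun i => a i (t *: x + x') *: y i) @ \oo --> t *: l + l'.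
Proof.
move=> xl xl'.
have -> : series (fun i => a i (t *: x + x') *: y i) =
    (fun n => t *: series (fun i => a i x *: y i) n
      + series (fun i => a i x' *: y i) n).
  apply/funext => n; rewrite /series /= scaler_sumr -big_split /=.
  by apply: eq_bigr => i _; rewrite linearP scalerDl scalerA.
by apply: cvgD => //; apply: cvgZl_tmp.
Qed.

(** On the largest domain of [x |-> sum_i a_i(x) y_i], belonging to the domain and
    having the right value amount to convergence of the series. *)
Lemma synth_ex : exists T : operator E F,
  forall x l, series (fun i => a i x *: y i) @ \oo --> l <-> dom T x /\ T x = l.
Proof.
pose L x : F := limn (series (fun i => a i x *: y i)).
have LE x l : series (fun i => a i x *: y i) @ \oo --> l -> L x = l.
  by move=> xl; apply/cvg_lim => //; exact: norm_hausdorff.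
have d0 : synth_dom a y 0.
  apply/cvg_ex; exists 0; rewrite (_ : series _ = fun=> 0); first exact: cvg_cst.
  by apply/funext => n; rewrite /series /= big1// => i _; rewrite linear0 scale0r.
have dl (t : K) x x' : synth_dom a y x -> synth_dom a y x' ->
    synth_dom a y (t *: x + x').
  move=> /cvg_ex[l xl] /cvg_ex[l' xl']; apply/cvg_ex.
  by exists (t *: l + l'); exact: synth_lin.
have Ll (t : K) x x' : synth_dom a y x -> synth_dom a y x' ->
    L (t *: x + x') = t *: L x + L x'.
  move=> /cvg_ex[l xl] /cvg_ex[l' xl']; rewrite (LE _ _ xl) (LE _ _ xl').
  exact/LE/synth_lin.
exists (Operator d0 dl Ll) => x l; split=> [xl|[/cvg_ex[l' xl'] <-]].
  by split; [apply/cvg_ex; exists l|exact: LE].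
by rewrite /= (LE _ _ xl').
Qed.

Variable u : nat -> E.
Hypothesis biorth : forall i j, a i (u j) = (i == j)%:R.

(** The series for [u j] has a single nonzero term. *)
Lemma synth_basis j n : (j < n)%N -> series (fun i => a i (u j) *: y i) n = y j.
Proof.
move=> jn; rewrite (series_single (j := j))//; first by rewrite biorth eqxx scale1r.
by move=> i /negbTE ij; rewrite biorth ij scale0r.
Qed.

Lemma synth_basis_cvg j : series (fun i => a i (u j) *: y i) @ \oo --> y j.
Proof.
apply/cvgn_leP => e e0; exists j.+1 => n jn.
by rewrite synth_basis// subrr normr0 ltW.
Qed.

(** [a i] is continuous and its value on the partial sums is eventually [c i]. *)
Lemma biorth_coef (c : nat -> K) x : (forall i, bounded_op (a i)) ->
  series (fun i => c i *: u i) @ \oo --> x -> forall i, a i x = c i.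
Proof.
move=> ab cx i; apply: cvgn_uniq (bounded_op_cvg (ab i) cx) _.
apply/cvgn_leP => e e0; exists i.+1 => n iln /=.
suff -> : a i (series (fun j => c j *: u j) n) = c i.
  by rewrite subrr normr0 ltW.
rewrite op_series (series_single (j := i))//=.
  by rewrite linearZ /= biorth eqxx -[LHS]/(c i * 1) mulr1.
move=> j; rewrite eq_sym linearZ /= biorth => /negbTE ->.
by rewrite -[LHS]/(c j * 0) mulr0.
Qed.

End Operators.

Arguments synth_basis_cvg {K E F a} y {u} biorth j.

(** * Frames *)

Section Frames.
Variables (K : scalarFieldType).
Hypotheses (HB : hahn_banach_ext K) (Kc : geo_complete (K^o : normedModType K)).
Variables (X : completeNormedModType K) (Xd : seq_space K).
Hypotheses (Xrefl : reflexive_space X) (hXd : RCB_space Xd).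
Local Notation delta := (canon_vec Xd).
Local Notation delta' := (dual_canon_vec Xd).
Implicit Types (g : nat -> dual X) (f : nat -> X).
Implicit Types T : {linear dual Xd -> dual X}.

Let CB : CB_space Xd := hXd.1.
Let Xdrefl : reflexive_space Xd := hXd.2.

Lemma coord_coef g x i : seq_in Xd (coef_seq g x) -> ss_coord i (coef Xd g x) = g i x.
Proof. by move=> gx; rewrite /ss_coord of_seqE. Qed.

Lemma coef_eq g x (c : Xd) : (forall i, ss_coord i c = g i x) ->
  seq_in Xd (coef_seq g x) /\ coef Xd g x = c.
Proof.
move=> cg; have -> : coef_seq g x = ss_seq c.
  by apply/funext => i; rewrite -[RHS]/(ss_coord i c) cg.
by split; [exists c|rewrite /coef (_ : coef_seq g x = ss_seq c)
  ?of_seqK//; apply/funext => i; rewrite -[RHS]/(ss_coord i c) cg].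
Qed.

Lemma dual_delta_coord i j : bidual_emb (delta i) (delta' j) = (i == j)%:R.
Proof. by rewrite bidual_embE (dual_deltaE CB Kc) coord_delta// eq_sym. Qed.

Lemma coord_op i : bounded_op (ss_coord i : Xd -> K^o).
Proof. by have [M _ cM] := coord_bounded CB Kc i; exists M => x _; exact: cM. Qed.

Lemma coef_linear_ex g : coefs_in Xd g ->
  exists U : {linear X -> Xd}, forall x, U x = coef Xd g x.
Proof.
move=> gin; have cl : linear (coef Xd g).
  move=> a x y; have [|_ ->//] := @coef_eq g (a *: x + y) (a *: coef Xd g x + coef Xd g y).
  by move=> i; rewrite !linearP /= !coord_coef.
pose U : {linear X -> Xd} := HB.pack (coef Xd g)
  (GRing.isLinear.Build _ _ _ _ _ cl).
by exists U.
Qed.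

(** The operator attached to a Bessel sequence [g] is the adjoint of its analysis
    operator [coef Xd g]. *)
Lemma Bessel_operator g : Xd_Bessel Xd g ->
  exists T, [/\ bounded_op T, forall V x, T V x = V (coef Xd g x) &
    forall i, g i = T (delta' i)].
Proof.
move=> [gin [B [B0 gB]]]; have [U UE] := coef_linear_ex gin.
have [|T Tb TU] := @precomp_ex K _ _ U.
  by exists B => x _; rewrite UE.
exists T; split=> // [V x|i]; first by rewrite TU UE.
by apply: dual_ext => x; rewrite TU UE (dual_deltaE CB Kc) coord_coef.
Qed.

(** For fixed [x] the functional [V |-> T V x] on [Xd^*] is, by reflexivity, the
    evaluation at an element of [Xd], whose coordinates are the [g i x]. *)
Lemma operator_Bessel g T : bounded_op T -> (forall i, g i = T (delta' i)) ->
  Xd_Bessel Xd g /\ forall V x, T V x = V (coef Xd g x).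
Proof.
move=> /bounded_op_gt0[M M0 TM] gT.
have gP x : [/\ seq_in Xd (coef_seq g x), `|coef Xd g x| <= M * `|x| &
    forall V, T V x = V (coef Xd g x)].
  have [|||G GE GM] := @dual_ex K (dual Xd) (fun V => T V x) (M * `|x|).
  - by rewrite mulr_ge0// ltW.
  - by move=> a V W; rewrite linearP.
  - move=> V; rewrite (le_trans (ler_dual _ _))// mulrAC ler_wpM2r//.
  have [c Gc] := Xdrefl G.
  have [|gx ->] := @coef_eq g x c.
    by move=> i; rewrite -(dual_deltaE CB Kc) -(bidual_embE c) Gc GE gT.
  split=> //; first by rewrite -(norm_bidual_emb HB) Gc.
  by move=> V; rewrite -(bidual_embE c) Gc GE.
split; last by move=> V x; have [] := gP x.
split; first by move=> x; have [] := gP x.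
by exists M; split=> // x; have [] := gP x.
Qed.

(** Only the lower bound is at stake, and it is dual to surjectivity by the closed
    range theorem. *)
Lemma Bessel_frame_bounds g T : Xd_Bessel Xd g -> bounded_op T ->
  (forall V x, T V x = V (coef Xd g x)) -> frame_bounds Xd g <-> surjective T.
Proof.
move=> [gin [B [B0 gB]]] Tb TE; split.
  move=> [A [B1 [A0 _ gA]]] phi; have [U UE] := coef_linear_ex gin.
  have [|V VU] := bounded_below_surj HB (U := U) A0 _ phi.
    by move=> x; rewrite UE; have /andP[] := gA x.
  by exists V; apply: dual_ext => x; rewrite TE -UE.
move=> Ts; have [A A0 gA] := surj_bounded_below HB Kc TE Tb Ts.
by exists A, B; split=> // x; rewrite gA gB.
Qed.

Lemma frame_Bessel g : Xd_frame Xd g -> Xd_Bessel Xd g.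
Proof.
by move=> [gin [A [B [A0 B0 gAB]]]]; split=> //; exists B; split=> // x;
  have /andP[] := gAB x.
Qed.

Lemma frame_operator g : Xd_frame Xd g ->
  exists T, [/\ bounded_op T, surjective T, forall V x, T V x = V (coef Xd g x) &
    forall i, g i = T (delta' i)].
Proof.
move=> fg; have gB := frame_Bessel fg.
have [T [Tb TE gT]] := Bessel_operator gB.
by exists T; split=> //; apply/(Bessel_frame_bounds gB Tb TE); case: fg.
Qed.

Lemma operator_frame g T : bounded_op T -> surjective T ->
  (forall i, g i = T (delta' i)) ->
  Xd_frame Xd g /\ forall V x, T V x = V (coef Xd g x).
Proof.
move=> Tb Ts gT; have [gB TE] := operator_Bessel Tb gT.
by split=> //; split; [case: gB|apply/(Bessel_frame_bounds gB Tb TE)].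
Qed.

(** With both bidual identifications, the adjoint of the adjoint of [U] is [U]. *)
Lemma reflexive_adjointE T (U : X -> Xd) x :
  (forall V x, T V x = V (U x)) -> reflexive_adjoint T x = U x.
Proof.
move=> TU; rewrite -[RHS](bidual_embK HB); congr bidual_inv.
apply: dual_ext => V; rewrite (@adjointP _ _ _ (total_op T) _ (bidual_emb (U x)))//.
  by rewrite !bidual_embE -TU.
by move=> W _; rewrite !bidual_embE -TU.
Qed.

Lemma Bessel_iff g : Xd_Bessel Xd g <->
  exists T, bounded_op T /\ (forall i, g i = T (delta' i)).
Proof.
split; first by move=> /Bessel_operator[T [Tb _ gT]]; exists T.
by move=> [T [Tb gT]]; have [] := operator_Bessel Tb gT.
Qed.

Lemma frame_iff g : Xd_frame Xd g <->
  exists T, [/\ bounded_op T, surjective T & forall i, g i = T (delta' i)].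
Proof.
split; first by move=> /frame_operator[T [Tb Ts _ gT]]; exists T.
by move=> [T [Tb Ts gT]]; have [] := operator_frame Tb Ts gT.
Qed.

(** Adjoints exchange left inverses of the analysis operator with right inverses
    of [T]. *)
Lemma Banach_frame_iff g : Banach_frame Xd g <->
  exists T, [/\ bounded_op T, surjective T,
     (exists U : {linear dual X -> dual Xd},
        bounded_op U /\ forall F, T (U F) = F) &
     forall i, g i = T (delta' i)].
Proof.
split.
  move=> [gin gfb [Q [Qb Qg]]].
  have [T [Tb Ts TE gT]] := frame_operator (conj gin gfb).
  have [U Ub UQ] := precomp_ex Qb; exists T; split=> //; exists U; split=> // F.
  by apply: dual_ext => x; rewrite TE UQ Qg.
move=> [T [Tb Ts [S [Sb TS]] gT]].
have [[gin gfb] TE] := operator_frame Tb Ts gT; split=> //.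
(* [Q] is the adjoint of [S], read through both reflexivities *)
have [S' S'b S'E] := precomp_ex Sb.
pose q (c : Xd) : X := bidual_inv (S' (bidual_emb c)).
have qE c (F : dual X) : F (q c) = S F c.
  by rewrite -(bidual_embE (q c)) (bidual_invK HB Xrefl) S'E bidual_embE.
have ql : linear q.
  by move=> a c d; apply: (dual_separates HB) => F; rewrite qE [RHS]linearP /= !qE linearP.
pose Q : {linear Xd -> X} := HB.pack q (GRing.isLinear.Build _ _ _ _ _ ql).
exists Q; split; last first.
  by move=> x; apply: (dual_separates HB) => F; rewrite qE -TE TS.
have [M M0 SM] := bounded_op_gt0 S'b; exists M => c _.
rewrite -(norm_bidual_emb HB (q c)) (bidual_invK HB Xrefl).
by rewrite (le_trans (SM _))// (norm_bidual_emb HB).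
Qed.

(** The left inverse [L] is unbounded in general: the series [sum_i c_i f_i] need
    not converge for every [c] in [Xd]. *)
Lemma atomic_synthesis g f : atomic_decomposition Xd g f ->
  exists L : operator Xd X, [/\ forall x, dom L (coef Xd g x) /\ L (coef Xd g x) = x,
    forall i, dom L (delta i) & forall i, L (delta i) = f i].
Proof.
move=> [gin gfb gf]; have [L LP] := synth_ex (ss_coord (Xd := Xd)) f.
have Ld i := (LP _ _).1 (synth_basis_cvg f (coord_delta CB) i).
exists L; split=> [x|i|i]; try by case: (Ld i).
apply/LP.
have -> : (fun i => ss_coord i (coef Xd g x) *: f i) = (fun i => g i x *: f i).
  by apply/funext => i; rewrite coord_coef.
exact: gf.
Qed.

Lemma dom_lin_span (E F : normedModType K) (T : operator E F) (u : nat -> E) :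
  (forall i, dom T (u i)) -> lin_span u `<=` dom T.
Proof. by move=> Tu _ [n [c ->]]; have [] := op_lin_sum c n Tu. Qed.

(** The partial sums in the condition on [L] are those of the canonical expansion
    of [coef Xd g x], so the condition says that [x] is the sum of the series
    [sum_i g_i(x) L(delta_i)]. *)
Lemma atomic_frame_iff g : (exists f, atomic_decomposition Xd g f) <->
  exists T, [/\ bounded_op T, surjective T,
     (exists L : operator Xd X,
        [/\ range (reflexive_adjoint T) `<=` dom L,
            lin_span delta `<=` dom L,
            (forall x : X, L (reflexive_adjoint T x) = x) &
            forall x : X,
              let s := series (fun i => T (delta' i) x *: delta i) in
              (fun n => L (s n)) @ \oo --> L (limn s)]) &
     forall i, g i = T (delta' i)].
Proof.
have sE T x : (forall V x, T V x = V (coef Xd g x)) -> coefs_in Xd g ->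
    series (fun i => T (delta' i) x *: delta i) = (fun n => psum n (coef Xd g x)).
  move=> TE gin; apply/funext => n; apply: eq_bigr => i _.
  by rewrite TE (dual_deltaE CB Kc).
have limE (c : Xd) : limn (fun n => psum n c) = c.
  by apply/cvg_lim; [exact: norm_hausdorff|exact: psum_cvg].
split.
  move=> [f gf]; have [gin gfb gfx] := gf.
  have [T [Tb Ts TE gT]] := frame_operator (conj gin gfb).
  have [L [LU Ld Lf]] := atomic_synthesis gf.
  exists T; split=> //; exists L; split.
  - by move=> _ [x _ <-]; rewrite (reflexive_adjointE _ TE); case: (LU x).
  - exact: dom_lin_span.
  - by move=> x; rewrite (reflexive_adjointE _ TE); case: (LU x).
  move=> x; rewrite /= (sE T)// limE; have [_ ->] := LU x.
  have -> : (fun n => L (psum n (coef Xd g x))) = series (fun i => g i x *: f i).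
    apply/funext => n; rewrite /psum.
    have [_ ->] := op_lin_sum (fun i => ss_coord i (coef Xd g x)) n Ld.
    by apply: eq_bigr => i _; rewrite Lf coord_coef.
  exact: gfx.
move=> [T [Tb Ts [L [_ Ld LU Ls]] gT]].
have [[gin gfb] TE] := operator_frame Tb Ts gT.
exists (fun i => L (delta i)); split=> // x.
have LU' : L (coef Xd g x) = x by rewrite -(reflexive_adjointE x TE) LU.
have := Ls x; rewrite /= (sE T)// limE LU'.
suff -> : (fun n => L (psum n (coef Xd g x))) = series (fun i => g i x *: L (delta i)).
  by [].
apply/funext => n; rewrite /psum.
have [|_ ->] := @op_lin_sum _ _ _ L delta (fun i => ss_coord i (coef Xd g x)) n.
  by move=> i; apply/Ld/lin_span_gen.
by apply: eq_bigr => i _; rewrite coord_coef.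
Qed.

(** The right inverse [U] is the analysis operator of [g]: conversely [g] is
    obtained from [U] as its coordinates, and surjectivity of [U^*] is the lower
    frame bound. *)
Lemma atomic_synthesis_iff f : (exists g, atomic_decomposition Xd g f) <->
  exists T : operator Xd X,
    [/\ lin_span delta `<=` dom T,
        series_continuous T delta,
        (exists U : {linear X -> Xd},
           [/\ bounded_op U, range U `<=` dom T,
               (forall x : X, T (U x) = x) &
               adjoint (total_op U) @` adjoint_dom (total_op U) = setT]) &
        forall i, f i = T (delta i)].
Proof.
split.
  move=> [g gf]; have [gin [A [B [A0 B0 gAB]]] gfx] := gf.
  have [U UE] := coef_linear_ex gin.
  have [L LP] := synth_ex (ss_coord (Xd := Xd)) f.
  have LU x : dom L (U x) /\ L (U x) = x.
    apply/LP.
    have -> : (fun i => ss_coord i (U x) *: f i) = (fun i => g i x *: f i).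
      by apply/funext => i; rewrite UE coord_coef.
    exact: gfx.
  have Ld i := (LP _ _).1 (synth_basis_cvg f (coord_delta CB) i).
  have Ub : bounded_op U by exists B => x _; rewrite UE; case/andP: (gAB x).
  exists L; split.
  - by apply: dom_lin_span => i; case: (Ld i).
  - move=> c x cx Lx.
    have xc := biorth_coef (coord_delta CB) coord_op cx.
    have Ld' i : dom L (delta i) by case: (Ld i).
    have -> : (fun n => L (series (fun i => c i *: delta i) n)) =
        series (fun i => ss_coord i x *: f i).
      apply/funext => n; have [_ ->] := op_lin_sum c n Ld'.
      by apply: eq_bigr => i _; have [_ ->] := Ld i; rewrite xc.
    by apply/LP.
  - exists U; split=> //.
    + by move=> _ [x _ <-]; case: (LU x).
    + by move=> x; case: (LU x).
    apply/seteqP; split=> // phi _.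
    have [|V VU] := bounded_below_surj HB (U := U) A0 _ phi.
      by move=> x; rewrite UE; case/andP: (gAB x).
    exists V.
      exists `|phi| => x _; rewrite [V _]VU; exact: ler_dual.
    by apply: dual_ext => x; rewrite (adjointP (psi := phi)) => [|y _|//]; rewrite /= VU.
  - by move=> i; have [_ ->] := Ld i.
move=> [T [Td Tc [U [Ub UT TU Us]] fT]].
have [W Wb WU] := precomp_ex Ub.
have Ws : surjective W.
  move=> phi; have [V _ Vphi] : (adjoint (total_op U) @` adjoint_dom (total_op U)) phi.
    by rewrite Us.
  exists V; rewrite -Vphi; apply: dual_ext => x.
  by rewrite (adjointP (psi := W V))//= WU.
pose g i := W (delta' i).
have [[gin gfb] WE] := operator_frame Wb Ws (fun i => erefl (g i)).
have gE i x : g i x = ss_coord i (U x) by rewrite /g WU (dual_deltaE CB Kc).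
exists g; split=> // x.
have := Tc (fun i => ss_coord i (U x)) (U x) (@psum_cvg _ _ CB (U x)).
have Td' i : dom T (delta i) by apply/Td/lin_span_gen.
have -> : (fun n => T (series (fun i => ss_coord i (U x) *: delta i) n)) =
    series (fun i => g i x *: f i).
  apply/funext => n; have [_ ->] := op_lin_sum (fun i => ss_coord i (U x)) n Td'.
  by apply: eq_bigr => i _; rewrite gE fT.
by rewrite TU; apply; apply: UT; exists x.
Qed.

(** The bounds on [T : c |-> sum_i c_i f_i] make its range closed, while density of
    the span makes it dense; the lower bound for a given bijective [T] is the open
    mapping theorem. *)
Lemma Riesz_basis_iff f : Xd_Riesz_basis Xd f <->
  exists T : {linear Xd -> X},
    [/\ bounded_op T, bijective T & forall i, f i = T (delta i)].
Proof.
split.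
  move=> [fdense [A [B [A0 B0 fAB]]]].
  have /choice[t tP] := fAB.
  have tl : linear t.
    move=> a c d; have [+ _] := tP (a *: c + d); move=> /cvgn_uniq; apply.
    exact: (@synth_lin K Xd X (ss_coord (Xd := Xd)) f a c d _ _ (tP c).1 (tP d).1).
  pose T : {linear Xd -> X} := HB.pack t (GRing.isLinear.Build _ _ _ _ _ tl).
  have Tlow c : A * `|c| <= `|T c| by have [_ /andP[]] := tP c.
  have Tb : bounded_op T by exists B => c _; have [_ /andP[]] := tP c.
  have fT i : f i = T (delta i).
    have [h _] := tP (delta i); apply: cvgn_uniq h.
    exact: (synth_basis_cvg f (coord_delta CB)).
  clearbody T.
  have Tapp y (e : K) : 0 < e -> exists c, `|y - T c| < e.
    move=> e0; have [|z [ye [n [c zE]]]] := fdense (ball y e) _ (ball_open y e).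
      by exists y; exact: ballxx.
    exists (series (fun i => c i *: delta i) n); move: ye; rewrite -ball_normE zE.
    suff -> : T (series (fun i => c i *: delta i) n) =
        \sum_(0 <= i < n) c i *: f i by [].
    by rewrite op_series; apply: eq_bigr => i _; rewrite /= linearZ fT.
  have Ts : surjective T.
    move=> y; have /choice[c cy] : forall n, exists c, `|y - T c| < 2^-1 ^+ n.
      by move=> n; exact/Tapp/half_gt0.
    have dc n : `|c n.+1 - c n| <= 2 / A * 2^-1 ^+ n.
      rewrite mulrAC ler_pdivlMr// mulrC (le_trans (Tlow _))// linearB /=.
      have -> : T (c n.+1) - T (c n) = (y - T (c n)) - (y - T (c n.+1)).
        by rewrite opprB [RHS]addrC subrKA.
      rewrite (le_trans (ler_normB _ _))// mulrC mulr_natr mulr2n lerD ?(ltW (cy _))//.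
      rewrite (le_trans (ltW (cy _)))// exprSr ler_piMr ?(ltW (half_gt0 _ _))//.
      by rewrite invf_le1// ler1n.
    have [l cl] := @complete_geo K Xd c _ dc; exists l.
    apply: cvgn_uniq (bounded_op_cvg Tb cl) _; apply/cvgn_leP => e e0.
    have [N hN] := half_small (ler01 : 0 <= 1 :> K) e0; exists N => n Nn /=.
    by rewrite (le_trans (ltW (cy n)))//; have := hN n Nn; rewrite mul1r.
  have Ti : injective T.
    move=> c d Tcd; apply/eqP; rewrite -subr_eq0 -normr_le0 -(pmulr_rle0 _ A0).
    by rewrite (le_trans (Tlow _))// linearB /= Tcd subrr normr0.
  exists T; split=> //; have [S TS] := choice Ts; exists S => // c.
  by apply: Ti; rewrite TS.
move=> [T [Tb Tbij fT]]; have Ti := bij_inj Tbij.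
have Ts : surjective T by move=> y; case: Tbij => S _ TS; exists (S y).
have [C C0 TC] := open_mapping (@complete_geo K Xd) (@complete_geo K X) Tb Ts.
have sT (c : Xd) : series (fun i => ss_coord i c *: f i) = T \o (fun n => psum n c).
  apply/funext => n /=; rewrite /psum op_series; apply: eq_bigr => i _.
  by rewrite /= linearZ fT.
split.
  move=> O [y Oy] Oop; have [c Tc] := Ts y.
  have := bounded_op_cvg Tb (@psum_cvg _ _ CB c).
  rewrite Tc => /(_ O)[|N _ /(_ N (leqnn N)) ON]; first exact: open_nbhs_nbhs.
  exists (T (psum N c)); split=> //.
  have -> : T (psum N c) = series (fun i => ss_coord i c *: f i) N by rewrite sT.
  exact: lin_span_series.
have [M M0 TM] := bounded_op_gt0 Tb.
exists C^-1, M; split; rewrite ?invr_gt0// => c; exists (T c); split.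
  by rewrite -/(ss_coord _ c) sT; exact: bounded_op_cvg Tb (@psum_cvg _ _ CB c).
rewrite TM andbT ler_pdivrMl//.
by have [d /Ti ->] := TC (T c).
Qed.

(** For the lower condition, [T] is the synthesis operator [V |-> sum_i V_i g_i] on
    its largest domain, and [T^*] is the analysis operator of [g] on the [x] whose
    coefficients are in [Xd]: for [F = x] in the domain of [T^*], a subspace of
    [X^** = X], the value [T^* F] is an element of [Xd^** = Xd] with coordinates
    [F (T delta'_i) = g_i x]. Conversely, if the coefficients of [x] form
    an element [c] of [Xd], series continuity of [T] along the expansion of [V]
    gives [(T V) x = V c], so that [x] is in the domain of [T^*] with value [c]. *)
Lemma lower_frame_iff g : lower_Xd_frame Xd g <->
  exists T : operator (dual Xd) (dual X),
    [/\ lin_span delta' `<=` dom T,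
        series_continuous T delta',
        (exists lambda : K, 0 < lambda /\
           forall F : dual (dual X), adjoint_dom T F ->
             lambda * `|F| <= `|adjoint T F|) &
        forall i, g i = T (delta' i)].
Proof.
split.
  move=> [A [A0 gA]].
  pose a i : {linear dual Xd -> K^o} := bidual_emb (delta i).
  have [T TP] := synth_ex a g.
  have ab i : bounded_op (a i) by exact: dual_bounded.
  have Td i := (TP _ _).1 (synth_basis_cvg g dual_delta_coord i).
  have Td1 i : dom T (delta' i) by case: (Td i).
  exists T; split.
  - exact: dom_lin_span.
  - move=> c V cV TV; have Vc := biorth_coef dual_delta_coord ab cV.
    have -> : (fun n => T (series (fun i => c i *: delta' i) n)) =
        series (fun i => a i V *: g i).
      apply/funext => n; have [_ ->] := op_lin_sum c n Td1.
      by apply: eq_bigr => i _; have [_ ->] := Td i; rewrite Vc.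
    by apply/TP.
  - exists A; split=> // F Fd; have [M M0 FM] := bounded_on_ge0 Fd.
    pose G := [set Va : dual Xd * K | exists2 V, dom T V & Va = (V, F (T V))].
    have [||psi0 psi0G _] := HB (G := G) M0.
    + split; first by exists 0; [exact: dom0|rewrite op0 linear0].
      move=> t _ _ _ _ [V TV [-> ->]] [W TW [-> ->]].
      by exists (t *: V + W); [exact: dom_lin|rewrite op_lin// linearP].
    + by move=> _ _ [V TV [-> ->]]; exact: FM.
    have psiE := adjointP (T := T) (phi := F) (fun V TV => psi0G _ _ (ex_intro2 _ _ V TV erefl)).
    set psi := adjoint T F in psiE *.
    have [x Fx] := Xrefl F; have [c psic] := Xdrefl psi.
    have [|gx cx] := @coef_eq g x c.
      move=> i; rewrite -(dual_deltaE CB Kc) -(bidual_embE c) psic psiE//.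
      by have [_ ->] := Td i; rewrite -Fx bidual_embE.
    by rewrite -Fx -psic !(norm_bidual_emb HB) -cx gA.
  - by move=> i; have [_ ->] := Td i.
move=> [T [Td Tc [lam [lam0 Tlam]] gT]]; exists lam; split=> // x gx.
have Td1 i : dom T (delta' i) by apply/Td/lin_span_gen.
set c := coef Xd g x.
have FT V : dom T V -> V c = bidual_emb x (T V).
  move=> TV.
  have Vd := Tc (fun i => V (delta i)) V (@dual_basis_cvg _ _ CB Kc V HB Xdrefl) TV.
  apply: cvgn_uniq (dual_cvg (phi := bidual_emb x) Vd).
  have -> : bidual_emb x \o (fun n =>
      T (series (fun i => V (delta i) *: delta' i) n)) =
      series (fun i => ss_coord i c * V (delta i)).
    apply/funext => n; rewrite /comp.
    have [_ ->] := op_lin_sum (fun i => V (delta i)) n Td1.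
    rewrite op_series; apply: eq_bigr => i _.
    transitivity (V (delta i) * g i x); first by rewrite /comp -gT.
    by rewrite coord_coef// mulrC.
  exact: dual_psum_cvg.
have Fd : adjoint_dom T (bidual_emb x).
  by exists `|c| => V TV; rewrite -FT// mulrC; exact: ler_dual.
have adjE V : dom T V -> adjoint T (bidual_emb x) V = V c.
  by move=> TV; rewrite (adjointP (psi := bidual_emb c) FT TV) -FT.
have adjc : adjoint T (bidual_emb x) = bidual_emb c.
  have [c' c'E] := Xdrefl (adjoint T (bidual_emb x)).
  rewrite -c'E; congr bidual_emb; apply: (@ss_inj _ Xd); apply/funext => i.
  rewrite -![ss_seq _ _]/(ss_coord i _) -!(dual_deltaE CB Kc) -(adjE _ (Td1 i)).
  by rewrite -c'E bidual_embE.
by have := Tlam _ Fd; rewrite adjc !(norm_bidual_emb HB).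
Qed.

End Frames.

(** * The seven correspondences *)

Theorem theorem3p1 (R : realType) (K : scalarFieldType)
    (hK : K = R :> scalarFieldType \/ K = R[i] :> scalarFieldType)
    (X : completeNormedModType K)
    (hXdim : infinite_dimensional X) (hXsep : separable X)
    (hXrefl : reflexive_space X)
    (Xd : seq_space K) (hXd : RCB_space Xd) :
  (* (i) *)
  (forall g : nat -> dual X,
     Xd_Bessel Xd g <->
     exists T : {linear dual Xd -> dual X},
       bounded_op T /\ (forall i, g i = T (dual_canon_vec Xd i))) /\
  (* (ii) *)
  (forall g : nat -> dual X,
     lower_Xd_frame Xd g <->
     exists T : operator (dual Xd) (dual X),
       [/\ lin_span (dual_canon_vec Xd) `<=` dom T,
           series_continuous T (dual_canon_vec Xd),
           (exists lambda : K, 0 < lambda /\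
              forall F : dual (dual X), adjoint_dom T F ->
                lambda * `|F| <= `|adjoint T F|) &
           forall i, g i = T (dual_canon_vec Xd i)]) /\
  (* (iii) *)
  (forall g : nat -> dual X,
     Xd_frame Xd g <->
     exists T : {linear dual Xd -> dual X},
       [/\ bounded_op T, surjective T & forall i, g i = T (dual_canon_vec Xd i)]) /\
  (* (iv) *)
  (forall g : nat -> dual X,
     Banach_frame Xd g <->
     exists T : {linear dual Xd -> dual X},
       [/\ bounded_op T, surjective T,
           (exists U : {linear dual X -> dual Xd},
              bounded_op U /\ forall F, T (U F) = F) &
           forall i, g i = T (dual_canon_vec Xd i)]) /\
  (* (v) *)
  (forall g : nat -> dual X,
     (exists f : nat -> X, atomic_decomposition Xd g f) <->
     exists T : {linear dual Xd -> dual X},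
       [/\ bounded_op T, surjective T,
           (exists L : operator Xd X,
              [/\ range (reflexive_adjoint T) `<=` dom L,
                  lin_span (canon_vec Xd) `<=` dom L,
                  (forall x : X, L (reflexive_adjoint T x) = x) &
                  forall x : X,
                    let s := series
                      (fun i => T (dual_canon_vec Xd i) x *: canon_vec Xd i) in
                    (fun n => L (s n)) @ \oo --> L (limn s)]) &
           forall i, g i = T (dual_canon_vec Xd i)]) /\
  (* (vi) *)
  (forall f : nat -> X,
     (exists g : nat -> dual X, atomic_decomposition Xd g f) <->
     exists T : operator Xd X,
       [/\ lin_span (canon_vec Xd) `<=` dom T,
           series_continuous T (canon_vec Xd),
           (exists U : {linear X -> Xd},
              [/\ bounded_op U, range U `<=` dom T,
                  (forall x : X, T (U x) = x) &
                  adjoint (total_op U) @` adjoint_dom (total_op U) = setT]) &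
           forall i, f i = T (canon_vec Xd i)]) /\
  (* (vii) *)
  (forall f : nat -> X,
     Xd_Riesz_basis Xd f <->
     exists T : {linear Xd -> X},
       [/\ bounded_op T, bijective T & forall i, f i = T (canon_vec Xd i)]).
Proof.
have HB : hahn_banach_ext K.
  by case: hK => ->; [exact: real_hahn_banach_ext|exact: complex_hahn_banach_ext].
have Kc : geo_complete (K^o : normedModType K).
  by case: hK => ->; [exact: real_geo_complete|exact: complex_geo_complete].
split; first by move=> g; exact: Bessel_iff.
split; first by move=> g; exact: lower_frame_iff.
split; first by move=> g; exact: frame_iff.
split; first by move=> g; exact: Banach_frame_iff.
split; first by move=> g; exact: atomic_frame_iff.
split; first by move=> f; exact: atomic_synthesis_iff.
by move=> f; exact: Riesz_basis_iff.
Qed.
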